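(* Assume the setting in the context and let $m$ be a positive integer. There exist a positive integer $D_0$ and a family $\tilde\Theta=\{\tilde\theta(a)\}_{a\in A}$, each $f(\cdot,\tilde\theta(a))$ a residual network of size $(d,(6^{\alpha}+1)m,D_0,\alpha+1)$, such that $$\mathcal R_{\mathcal D}(\tilde\Theta)\le\frac{1}{(1-\gamma)^2}\Big(256|A|^5\frac{\|r\|_{\mathcal B}^2}{m}+576\,\gamma^2C_T^2(\Delta t)^2|A|^7\|r\|_{\mathcal B}^2\Big)$$ and $\|\tilde\Theta\|_{\mathcal P}\le\frac{24}{1-\gamma}|A|^{7/2}\|r\|_{\mathcal B}$.
   Context: Residual networks: for positive integers $d,m,D,L$, a residual network of size $(d,m,D,L)$ is a function $f(\cdot,\theta):\mathbb R^d\to\mathbb R$, $f(x,\theta)=u^{\top}h^{[L]}$, where $h^{[0]}=Vx$ and $h^{[l]}=h^{[l-1]}+U^{[l]}\sigma(W^{[l]}h^{[l-1]})$ for $l=1,\dots,L$, with $V\in\mathbb R^{D\times d}$, $W^{[l]}\in\mathbb R^{m\times D}$, $U^{[l]}\in\mathbb R^{D\times m}$, $u\in\mathbb R^D$, $\sigma(z)=\max(z,0)$ applied entrywise, and $\theta=(u,V,\{W^{[l]}\}_{l=1}^L,\{U^{[l]}\}_{l=1}^L)$. Its weighted path norm is $\|\theta\|_{\mathcal P}=\big\||u|^{\top}(I+3|U^{[L]}||W^{[L]}|)\cdots(I+3|U^{[1]}||W^{[1]}|)|V|\big\|_1$, where $|\cdot|$ of a matrix/vector is entrywise absolute value and $I$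 is the $D\times D$ identity. For a family $\Theta=\{\theta(a)\}_{a\in A}$ of parameters (one network per action, all of the same size), $f(s,\theta(a))$ denotes the $a$-th network and $\|\Theta\|_{\mathcal P}=\sum_{a\in A}\|\theta(a)\|_{\mathcal P}$. Barron space: for a compact $S\subset\mathbb R^d$, $h:S\to\mathbb R$ is in the Barron space $\mathcal B(S)$ if there is a probability measure $\rho$ on $\mathbb R\times\mathbb R^d$ with $h(x)=\mathbb E_{(u,w)\sim\rho}[u\,\sigma(w^{\top}x)]$ for all $x\in S$; its Barron norm is $\|h\|_{\mathcal B}=\inf_\rho(\mathbb E_{\rho}[u^2\|w\|_1^2])^{1/2}$, the infimum over all such $\rho$. For $r:S\times A\to\mathbb R$ with each $r(\cdot,a)\in\mathcal B(S)$, $\|r\|_{\mathcal B}=(\sum_{a\in A}\|r(\cdot,a)\|_{\mathcal B}^2)^{1/2}$. Setting: $S\subseteq[0,1]^d$ is compact with positive Lebesgue measure (state space); $A$ is a finite action set with $|A|=2^{\alpha}$, $\alpha\ge 0$ an integer, identified with $\{1,\dots,2^\alpha\}$; $\gamma\in(0,1)$. The reward $r:S\times A\to\mathbb R$ satisfies: each $r(\cdot,a)$ is continuous and lies in $\mathcal B(S)$, and $|r(s,a)|\le 1$ for all $(s,a)$. The transition $\tilde g:S\times A\times[0,\infty)\to S$ satisfies $\tilde g(s,a,0)=s$, $\tilde g(\tilde g(s,a,t),a,t')=\tilde g(s,a,t+t')$ for $t,t'\ge0$, and there is $C_T>0$ with $\|\tilde g(s,a,t)-\tilde g(s,a,t+\Delta)\|_\infty\le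 C_T\Delta$ for all $s\in S,a\in A,t\ge0,\Delta\in(0,1)$. A time step $\Delta t\in(0,1)$ is fixed. $\mathcal D$ is the uniform distribution on $S$ and $\mathcal U$ the uniform distribution on $A$. The Bellman optimal loss is $\mathcal R_{\mathcal D}(\Theta)=\frac12\mathbb E_{s\sim\mathcal D,a\sim\mathcal U}\big(f(s,\theta(a))-r(s,a)-\gamma\max_{a'\in A}f(s',\theta(a'))\big)^2$ with $s'=\tilde g(s,a,\Delta t)$. *)

(* Defs.v *)
From HB Require Import structures.
From mathcomp Require Import all_boot all_order all_algebra.
From mathcomp Require Import all_classical all_reals all_analysis.
Set Implicit Arguments. Unset Strict Implicit. Unset Printing Implicit Defensive.
Import Order.TTheory GRing.Theory Num.Theory.
Import numFieldNormedType.Exports.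
Local Open Scope classical_set_scope.
Local Open Scope ring_scope.

(* Residual networks of size (d,m,D,L).  Inputs x in R^d are row       *)
(* vectors 'rV_d; hidden states are column vectors 'cV_D.  Layer l     *)
(* (l = 1..L in the paper) is indexed by the ordinal l-1 : 'I_L.       *)
Record resnet (R : realType) (d m D L : nat) := ResNet {
  rn_u : 'cV[R]_D ;
  rn_V : 'M[R]_(D, d) ;
  rn_W : 'I_L -> 'M[R]_(m, D) ;
  rn_U : 'I_L -> 'M[R]_(D, m) }.

Definition relu (R : realType) (z : R) : R := Num.max z 0.
Definition relu_mx (R : realType) m n (M : 'M[R]_(m, n)) : 'M[R]_(m, n) :=
  map_mx (@relu R) M.
Definition abs_mx (R : realType) m n (M : 'M[R]_(m, n)) : 'M[R]_(m, n) :=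
  map_mx (fun z : R => `|z|) M.

Definition rn_hidden (R : realType) d m D L (th : resnet R d m D L)
    (x : 'rV[R]_d) : 'cV[R]_D :=
  foldl (fun h l => h + rn_U th l *m relu_mx (rn_W th l *m h))
        (rn_V th *m x^T) (enum 'I_L).

Definition rn_eval (R : realType) d m D L (th : resnet R d m D L)
    (x : 'rV[R]_d) : R :=
  ((rn_u th)^T *m rn_hidden th x) ord0 ord0.

Definition path_norm (R : realType) d m D L (th : resnet R d m D L) : R :=
  let M (l : 'I_L) : 'M[R]_D :=
    1%:M + 3%:R *: (abs_mx (rn_U th l) *m abs_mx (rn_W th l)) in
  let row := foldr (fun l (acc : 'rV[R]_D) => acc *m M l)
                   (abs_mx (rn_u th))^T (enum 'I_L) in
  \sum_(j < d) `|(row *m abs_mx (rn_V th)) ord0 j|.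

(* Lebesgue integral on R^d (nonnegative/extended-valued integrands),  *)
(* as the iterated Lebesgue integral over the coordinates.             *)
Definition cons_row (R : realType) d (x : R) (v : 'rV[R]_d) : 'rV[R]_d.+1 :=
  \row_(i < d.+1) (if unlift ord0 i is Some j then v ord0 j else x).

Fixpoint iint (R : realType) (d : nat) : ('rV[R]_d -> \bar R) -> \bar R :=
  match d with
  | 0 => fun g => g 0
  | d'.+1 => fun g =>
      (\int[@lebesgue_measure R]_x iint (fun v => g (cons_row x v)))%E
  end.

Definition leb_vol (R : realType) d (S : set 'rV[R]_d) : \bar R :=
  iint (fun s => (\1_S s)%:E).

Definition unif_exp (R : realType) d (S : set 'rV[R]_d) (h : 'rV[R]_d -> R)
  : \bar R :=
  (iint (fun s => (\1_S s * h s)%:E) * ((fine (leb_vol S))^-1)%:E)%E.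

(* Barron space.  R^d for the parameter w is d.-tuple R with the       *)
(* product (= Borel) sigma-algebra.                                    *)
Definition tdot (R : realType) d (w : d.-tuple R) (x : 'rV[R]_d) : R :=
  \sum_(i < d) tnth w i * x ord0 i.
Definition tnorm1 (R : realType) d (w : d.-tuple R) : R :=
  \sum_(i < d) `|tnth w i|.

Definition barron_moment (R : realType) d
    (rho : probability (R * d.-tuple R)%type R) : \bar R :=
  (\int[rho]_z ((z.1 ^+ 2 * tnorm1 z.2 ^+ 2)%:E))%E.

Definition barron_rep (R : realType) d (S : set 'rV[R]_d) (h : 'rV[R]_d -> R)
    (rho : probability (R * d.-tuple R)%type R) : Prop :=
  (barron_moment rho < +oo)%E /\
  forall x, S x -> (\int[rho]_z ((z.1 * relu (tdot z.2 x))%:E))%E = (h x)%:E.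

Definition in_barron (R : realType) d (S : set 'rV[R]_d) (h : 'rV[R]_d -> R)
  : Prop := exists rho, barron_rep S h rho.

Definition barron_norm (R : realType) d (S : set 'rV[R]_d) (h : 'rV[R]_d -> R)
  : R :=
  inf [set Num.sqrt (fine (barron_moment rho)) | rho in barron_rep S h].

(* Actions: A = 'I_(2^alpha).                                          *)
Lemma pow2_gt0 (alpha : nat) : (0 < 2 ^ alpha)%N.
Proof. by rewrite expn_gt0. Qed.

Definition act0 (alpha : nat) : 'I_(2 ^ alpha) := Ordinal (pow2_gt0 alpha).

Definition maxA (R : realType) (alpha : nat) (F : 'I_(2 ^ alpha) -> R) : R :=
  \big[Num.max/F (act0 alpha)]_(a < 2 ^ alpha) F a.

Definition barron_norm_r (R : realType) d alpha (S : set 'rV[R]_d)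
    (r : 'rV[R]_d -> 'I_(2 ^ alpha) -> R) : R :=
  Num.sqrt (\sum_(a < 2 ^ alpha) barron_norm S (fun s => r s a) ^+ 2).

Definition family_path_norm (R : realType) d m D L alpha
    (Th : 'I_(2 ^ alpha) -> resnet R d m D L) : R :=
  \sum_(a < 2 ^ alpha) path_norm (Th a).

Definition bellman_loss (R : realType) d m D L alpha (S : set 'rV[R]_d)
    (r : 'rV[R]_d -> 'I_(2 ^ alpha) -> R)
    (g : 'rV[R]_d -> 'I_(2 ^ alpha) -> R -> 'rV[R]_d)
    (gamma dt : R) (Th : 'I_(2 ^ alpha) -> resnet R d m D L) : \bar R :=
  let h (s : 'rV[R]_d) : R :=
    (2 ^ alpha)%:R^-1 * \sum_(a < 2 ^ alpha)
        (rn_eval (Th a) s - r s a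
         - gamma * maxA (fun a' => rn_eval (Th a') (g s a dt))) ^+ 2 in
  ((2^-1)%:E * unif_exp S h)%E.

Definition linf_dist (R : realType) d (x y : 'rV[R]_d) : R :=
  \big[Num.max/0]_(i < d) `|x ord0 i - y ord0 i|.

(* Main.v *)
Require Import Defs.
From mathcomp Require Import all_boot all_order all_algebra finmap.
From mathcomp Require Import all_classical all_reals all_analysis.
From mathcomp Require Import measurable_realfun ring lra.
Import Order.TTheory GRing.Theory Num.Theory.
Import numFieldNormedType.Exports.
Set Implicit Arguments.
Unset Strict Implicit.
Unset Printing Implicit Defensive.
Local Open Scope classical_set_scope.
Local Open Scope ring_scope.

(* For dt = 0 the Bellman optimality equation is solved exactly by
   Q(s,a) = r(s,a) + gamma/(1-gamma) max_b r(s,b).  Each reward r(.,a) is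
   replaced by a two-layer network q_a with m neurons (Maurey's argument: draw
   the neurons one at a time from a nearly optimal Barron representation, so
   that the squared L2 error and the weight are controlled together), and the
   maximum over the 2^alpha actions is computed by a tournament of depth alpha,
   using max(x, y) = x + relu(y - x) inside the residual connections.  For
   s' = g(s,a,dt) the Bellman residual is then
     (q_a - r_a)(s) + gamma/(1-gamma) (max_b q_b(s) - max_b q_b(s')),
   whose second term is controlled by the Lipschitz constants of the q_b. *)

(** * Iterated Lebesgue integrals *)

(** The factor gamma/(1-gamma) comes from the ansatz Q = r + k max r: its maximum over the actions
    is (1 + k) max r, so the equation reduces to k = gamma (1 + k). The added term does not depend
    on the action, so the same computation holds with q_a in place of r, and the residual sees the
    transition only through a difference of two maxima. An L2 bound would not control that
    difference, since s' need not be uniformly distributed; a Lipschitz bound does. The sum of |u|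
    |w|_1 over the neurons bounds both this Lipschitz constant and the path norm, which is why error
    and weight must be small for the same neurons. Choosing them one by one needs only the mean over
    a single draw and Tonelli, never a product law. Each tournament round multiplies the path bound
    by 4, so the maximum costs 4^alpha = |A|^2 times the sum of all weights; summing over the |A|
    networks gives |A|^3, and Cauchy-Schwarz over the actions supplies the remaining |A|^(1/2). *)

Lemma le_integral_nomeas (disp : measure_display) (T : measurableType disp)
    (R : realType) (mu : {measure set T -> \bar R}) (f1 f2 : T -> \bar R) :
  (forall x, (0 <= f1 x)%E) -> (forall x, (f1 x <= f2 x)%E) ->
  (\int[mu]_x f1 x <= \int[mu]_x f2 x)%E.
Proof.
move=> f10 f12.
have f20 x : (0 <= f2 x)%E by exact: le_trans (f10 x) (f12 x).
(* A nonnegative integral is the supremum over the nonnegative simple functions below the integrand,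
   and a larger integrand only enlarges this family. *)
rewrite !ge0_integralTE//.
apply: le_ereal_sup => _ [h hf <-]; exists h => //.
by move=> x; exact: le_trans (hf x) (f12 x).
Qed.

Section IteratedIntegral.
Context {R : realType}.
Local Open Scope ereal_scope.

(** The product sigma-algebra is taken on tuples while [iint] ranges over row vectors; measurability
    on rows is always pulled back along this map. *)
Definition row_of_tuple n (t : n.-tuple R) : 'rV[R]_n := (\row_i tnth t i)%R.

Lemma row_of_tuple_cons n (x : R) (t : n.-tuple R) :
  row_of_tuple [tuple of x :: t] = cons_row x (row_of_tuple t).
Proof.
apply/rowP => i; rewrite !mxE.
by case: unliftP => [j ->|->]; rewrite ?mxE ?tnthS ?tnth0.
Qed.

Lemma row_of_tuple_nil (t : 0.-tuple R) : row_of_tuple t = 0%R.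
Proof. by apply/rowP => -[]. Qed.

Lemma row_of_tuple_surj n (x : 'rV[R]_n) :
  row_of_tuple [tuple x ord0 i | i < n] = x.
Proof. by apply/rowP => i; rewrite mxE tnth_mktuple. Qed.

Lemma iint_ge0 n (f : 'rV[R]_n -> \bar R) :
  (forall v, 0 <= f v) -> 0 <= iint f.
Proof.
elim: n f => [|n IH] f f0 /=; first exact: f0.
by apply: integral_ge0 => x _; exact: IH.
Qed.

Lemma le_iint n (f g : 'rV[R]_n -> \bar R) :
  (forall v, 0 <= f v) -> (forall v, f v <= g v) -> iint f <= iint g.
Proof.
elim: n f g => [|n IH] f g f0 fg /=; first exact: fg.
apply: le_integral_nomeas => x; first exact: iint_ge0.
exact: IH.
Qed.

(* The parameter space grows by one real coordinate at each step of the
   induction on the dimension, which is why it is quantified inside. *)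
Lemma measurable_iint n (disp : measure_display) (T : measurableType disp)
    (f : T -> 'rV[R]_n -> \bar R) :
  (forall t v, 0 <= f t v) ->
  measurable_fun setT (fun p : T * n.-tuple R => f p.1 (row_of_tuple p.2)) ->
  measurable_fun setT (fun t => iint (f t)).
Proof.
elim: n disp T f => [|n IH] disp T f f0 mf /=.
  pose c (t : T) : T * 0.-tuple R := (t, [tuple]).
  rewrite (_ : (fun t => f t 0%R) =
    (fun p : T * _.-tuple R => f p.1 (row_of_tuple p.2)) \o c).
    by apply: measurableT_comp => //; apply: measurable_fun_pair.
  by apply/funext => t /=; rewrite row_of_tuple_nil.
pose F (p : T * R) := iint (fun v => f p.1 (cons_row p.2 v)).
have mF : measurable_fun setT F.
  apply: (IH _ _ (fun (p : T * R) v => f p.1 (cons_row p.2 v))) => //.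
  pose c (q : (T * R) * n.-tuple R) : T * n.+1.-tuple R :=
    (q.1.1, [the n.+1.-tuple R of q.1.2 :: q.2]).
  rewrite (_ : (fun _ => _) =
    (fun p : T * _.-tuple R => f p.1 (row_of_tuple p.2)) \o c).
    apply: measurableT_comp => //; apply: measurable_fun_pair => /=.
      exact: measurableT_comp.
    by apply: measurable_cons => //; exact: measurableT_comp.
  by apply/funext => q /=; rewrite row_of_tuple_cons.
have := @measurable_fun_fubini_tonelli_F _ _ T _ R (@lebesgue_measure R) F mF.
by apply => p; exact: iint_ge0.
Qed.

(** One coordinate at a time: Tonelli swaps [mu] with the outermost Lebesgue integral, and the
    induction hypothesis applies at each fixed first coordinate. *)
Lemma iint_fubini n (disp : measure_display) (T : measurableType disp)
    (mu : {sigma_finite_measure set T -> \bar R}) (f : T -> 'rV[R]_n -> \bar R) :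
  (forall t v, 0 <= f t v) ->
  measurable_fun setT (fun p : T * n.-tuple R => f p.1 (row_of_tuple p.2)) ->
  \int[mu]_t iint (f t) = iint (fun v => \int[mu]_t f t v).
Proof.
elim: n f => [//|n IH] f f0 mf /=.
have mf' : measurable_fun setT (fun q : (T * R) * n.-tuple R =>
    f q.1.1 (cons_row q.1.2 (row_of_tuple q.2))).
  pose c (q : (T * R) * n.-tuple R) : T * n.+1.-tuple R :=
    (q.1.1, [the n.+1.-tuple R of q.1.2 :: q.2]).
  rewrite (_ : (fun _ => _) =
    (fun p : T * _.-tuple R => f p.1 (row_of_tuple p.2)) \o c).
    apply: measurableT_comp => //; apply: measurable_fun_pair => /=.
      exact: measurableT_comp.
    by apply: measurable_cons => //; exact: measurableT_comp.
  by apply/funext => q /=; rewrite row_of_tuple_cons.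
pose F (p : T * R) := iint (fun v => f p.1 (cons_row p.2 v)).
have mF : measurable_fun setT F.
  exact: (@measurable_iint n _ _ (fun (p : T * R) v => f p.1 (cons_row p.2 v))).
rewrite (fubini_tonelli (m1 := mu) (m2 := @lebesgue_measure R) F)//; last first.
  by move=> p; exact: iint_ge0.
apply: eq_integral => x _; apply: (IH (fun t v => f t (cons_row x v))) => //.
pose c (q : T * n.-tuple R) : (T * R) * n.-tuple R := ((q.1, x), q.2).
rewrite (_ : (fun _ => _) = (fun q : (T * R) * n.-tuple R =>
    f q.1.1 (cons_row q.1.2 (row_of_tuple q.2))) \o c)//.
apply: measurableT_comp => //; apply: measurable_fun_pair => //=.
exact: measurable_fun_pair.
Qed.

Definition row_measurable n (f : 'rV[R]_n -> \bar R) :=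
  measurable_fun setT (fun t : n.-tuple R => f (row_of_tuple t)).

Lemma row_measurable_cons n (f : 'rV[R]_n.+1 -> \bar R) :
  row_measurable f ->
  measurable_fun setT
    (fun p : R * n.-tuple R => f (cons_row p.1 (row_of_tuple p.2))).
Proof.
move=> mf.
pose c (q : R * n.-tuple R) : n.+1.-tuple R := [the n.+1.-tuple R of q.1 :: q.2].
rewrite (_ : (fun _ => _) = (fun t : n.+1.-tuple R => f (row_of_tuple t)) \o c).
  by apply: measurableT_comp => //; exact: measurable_cons.
by apply/funext => q /=; rewrite row_of_tuple_cons.
Qed.

Lemma row_measurable_consl n (f : 'rV[R]_n.+1 -> \bar R) (x : R) :
  row_measurable f -> row_measurable (fun v => f (cons_row x v)).
Proof.
move=> /row_measurable_cons mf.
pose c (q : n.-tuple R) : R * n.-tuple R := (x, q).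
rewrite /row_measurable.
rewrite (_ : (fun _ => _) =
  (fun p : R * n.-tuple R => f (cons_row p.1 (row_of_tuple p.2))) \o c)//.
by apply: measurableT_comp => //; exact: measurable_fun_pair.
Qed.

Lemma iintD n (f g : 'rV[R]_n -> \bar R) :
  (forall v, 0 <= f v) -> (forall v, 0 <= g v) ->
  row_measurable f -> row_measurable g ->
  iint (fun v => f v + g v) = iint f + iint g.
Proof.
elim: n f g => [//|n IH] f g f0 g0 mf mg /=.
rewrite -ge0_integralD//; last 4 first.
- by move=> x _; exact: iint_ge0.
- apply: (@measurable_iint n _ _ (fun x v => f (cons_row x v))) => //.
  exact: row_measurable_cons.
- by move=> x _; exact: iint_ge0.
- apply: (@measurable_iint n _ _ (fun x v => g (cons_row x v))) => //.
  exact: row_measurable_cons.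
apply: eq_integral => x _; apply: IH => //; exact: row_measurable_consl.
Qed.

Lemma iintZl n (c : R) (f : 'rV[R]_n -> \bar R) :
  (0 <= c)%R -> (forall v, 0 <= f v) -> row_measurable f ->
  iint (fun v => c%:E * f v) = c%:E * iint f.
Proof.
move=> c0; elim: n f => [//|n IH] f f0 mf /=.
rewrite -ge0_integralZl//; last 2 first.
- apply: (@measurable_iint n _ _ (fun x v => f (cons_row x v))) => //.
  exact: row_measurable_cons.
- by move=> x _; exact: iint_ge0.
apply: eq_integral => x _; apply: IH => //; exact: row_measurable_consl.
Qed.

Lemma eq_iint n (f g : 'rV[R]_n -> \bar R) : f =1 g -> iint f = iint g.
Proof. by move=> /funext ->. Qed.

Lemma iint0 n : iint (fun _ : 'rV[R]_n => 0) = 0.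
Proof. by elim: n => [//|n /= ->]; rewrite integral0. Qed.

Lemma iint_sum n (I : Type) (s : seq I) (f : I -> 'rV[R]_n -> \bar R) :
  (forall i v, 0 <= f i v) -> (forall i, row_measurable (f i)) ->
  iint (fun v => \sum_(i <- s) f i v) = \sum_(i <- s) iint (f i).
Proof.
move=> f0 mf; elim: s => [|i s IH].
  by rewrite big_nil -[RHS](iint0 n); apply: eq_iint => v; rewrite big_nil.
rewrite big_cons -IH -iintD//.
- by apply: eq_iint => v; rewrite big_cons.
- by move=> v; apply: sume_ge0.
- apply: emeasurable_sum => j; exact: mf.
Qed.

(** Slices at a first coordinate outside [0,1] are empty, the others have volume at most 1 by
    induction. Finiteness makes the normalisation by [fine (leb_vol S)] a genuine one. *)
Lemma leb_vol_cube_le1 n (S : set 'rV[R]_n) :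
  (forall s, S s -> forall i, (0 <= s ord0 i <= 1)%R) -> leb_vol S <= 1.
Proof.
rewrite /leb_vol; elim: n S => [|n IH] S S1 /=.
  by rewrite lee_fin indicE; case: (_ \in _).
have cr x v : cons_row x v ord0 ord0 = x :> R by rewrite mxE unlift_none.
apply: (@le_trans _ _ (\int[@lebesgue_measure R]_x
  (\1_(`[0%R, 1%R]%classic : set R) x)%:E)).
  apply: le_integral_nomeas => x.
    by apply: iint_ge0 => v; rewrite lee_fin.
  have [x01|x01] := boolP (x \in (`[0%R, 1%R]%classic : set R)); last first.
    rewrite indicE (negbTE x01).
    rewrite (_ : (fun _ => _) = (fun _ => 0)) ?iint0//.
    apply/funext => v; rewrite indicE memNset//= => /S1 /(_ ord0).
    by rewrite cr => h; move/negP: x01; apply; rewrite inE/= in_itv.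
  rewrite indicE x01.
  apply: le_trans (IH [set v | S (cons_row x v)] _) => //.
    move=> s /= /S1 + i => /(_ (lift ord0 i)).
    by rewrite mxE liftK.
rewrite integral_indic// setIT (_ : _ (`[0%R, 1%R]%classic : set R) = 1)//.
by rewrite [LHS]lebesgue_measure_itv/= lte_fin ltr01 oppr0 adde0.
Qed.

End IteratedIntegral.

(** By compactness and closedness, [S] is the intersection over k of finite unions of balls of
    radius 1/(k+1) centred in [S]; balls of the sup norm are boxes, hence measurable
    coordinatewise. *)
Lemma compact_row_measurable (R : realType) n (S : set 'rV[R]_n) :
  compact S -> measurable ((@row_of_tuple R n) @^-1` S).
Proof.
move=> cS.
have mball (x : 'rV[R]_n) (e : R) :
    measurable ((@row_of_tuple R n) @^-1` ball x e).
  have [e0|e0] := ltP 0 e; last first.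
    rewrite (_ : _ @^-1` _ = set0) //; apply/seteqP; split => // t.
    by case; rewrite ltNge e0.
  rewrite (_ : _ @^-1` _ =
      \bigcap_(i in [set: 'I_n]) ((fun t => tnth t i) @^-1` ball (x ord0 i) e)).
    apply: fin_bigcap_measurable => // i _.
    by rewrite -[X in measurable X]setTI;
      apply: measurable_tnth => //; exact: measurable_ball.
  apply/seteqP; split => [t [_ h] i _|t h].
    by move: (h ord0 i); rewrite mxE.
  by split => // i j; rewrite ord1 mxE; exact: h.
have cov (k : nat) : exists D : set 'rV[R]_n,
    [/\ finite_set D, D `<=` S & S `<=` \bigcup_(x in D) ball x k.+1%:R^-1].
  move: cS; rewrite compact_cover => 
    /(_ _ S (fun x => interior (ball x k.+1%:R^-1))).
  case.
  - by move=> x _; exact: open_interior.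
  - move=> x Sx; exists x => //; apply: nbhsx_ballx.
    by rewrite invr_gt0.
  move=> D DS SD; exists [set` D]; split; first exact: finite_fset.
    by move=> x /DS; rewrite in_setE.
  by move=> y /SD[x Dx /interior_subset xy]; exists x.
pose D k := projT1 (cid (cov k)).
have DP k : [/\ finite_set (D k), D k `<=` S &
    S `<=` \bigcup_(x in D k) ball x k.+1%:R^-1].
  exact: projT2 (cid (cov k)).
have SE : S = \bigcap_k \bigcup_(x in D k) ball x k.+1%:R^-1.
  apply/seteqP; split => [x Sx k _|x xD]; first by case: (DP k) => _ _; apply.
  have clS : closed S by apply: compact_closed => //; exact: norm_hausdorff.
  apply: clS => U /nbhs_ballP[e /= e0 xU].
  have [k ke] : exists k : nat, k.+1%:R^-1 < e.
    exists (Num.truncn e^-1); by rewrite invf_plt ?posrE// Num.Theory.truncnS_gt.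
  have [y Dy yx] := xD k I.
  exists y; split; first by case: (DP k) => _ + _; apply.
  by apply: xU; apply: le_ball (ltW ke) _ _; exact: ball_sym.
rewrite SE preimage_bigcap; apply: bigcap_measurable => // k _.
rewrite preimage_bigcup; apply: fin_bigcup_measurable => //.
by case: (DP k).
Qed.

(** * Neurons and Barron representations *)

Lemma relu_lipschitz (R : realType) (a b : R) :
  `|relu a - relu b| <= `|a - b|.
Proof.
have h1 := ler_norm (a - b).
have h2 : b - a <= `|a - b| by rewrite distrC ler_norm.
rewrite /relu !maxEle ler_norml.
by case: (leP a 0) => ?; case: (leP b 0) => ?; apply/andP; split; lra.
Qed.

Section Neuron.
Context {R : realType} {d : nat}.
Implicit Types (z : R * d.-tuple R) (x y : 'rV[R]_d).

Definition neuron z x : R := z.1 * relu (tdot z.2 x).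

(** At once a Lipschitz constant of the neuron for the sup distance, a bound for it on the unit cube
    and its share of the path norm; its mean square is the Barron moment. *)
Definition neuron_weight z : R := `|z.1| * tnorm1 z.2.

Lemma neuron_weight_ge0 z : 0 <= neuron_weight z.
Proof. by rewrite mulr_ge0// sumr_ge0. Qed.

Lemma neuron_lipschitz z x y :
  `|neuron z x - neuron z y| <= neuron_weight z * linf_dist x y.
Proof.
rewrite /neuron /neuron_weight -mulrBr normrM -mulrA ler_wpM2l//.
apply: le_trans (relu_lipschitz _ _) _.
rewrite /tdot -sumrB /tnorm1 mulr_suml.
apply: le_trans (ler_norm_sum _ _ _) _; apply: ler_sum => i _.
rewrite -mulrBr normrM ler_wpM2l//.
exact: (le_bigmax _ (fun i => `|x ord0 i - y ord0 i|)).
Qed.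

(** Compare with the origin, where the neuron vanishes and which lies at sup distance at most 1. *)
Lemma neuron_cube z x :
  (forall i, 0 <= x ord0 i <= 1) -> `|neuron z x| <= neuron_weight z.
Proof.
move=> x01; have := neuron_lipschitz z x 0.
have -> : neuron z 0 = 0.
  rewrite /neuron /tdot big1 ?/relu ?maxxx ?mulr0// => i _.
  by rewrite mxE mulr0.
rewrite subr0 => /le_trans; apply.
rewrite ler_piMr ?neuron_weight_ge0//; apply: bigmax_le => // i _.
by rewrite mxE subr0; have /andP[? ?] := x01 i; rewrite ger0_norm.
Qed.

Lemma measurable_neuron :
  measurable_fun setT
    (fun p : (R * d.-tuple R) * d.-tuple R => neuron p.1 (row_of_tuple p.2)).
Proof.
apply: measurable_funM; first exact: measurableT_comp.
apply: measurable_maxr => //; apply: measurable_sum => i.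
apply: measurable_funM.
  apply: (measurableT_comp (f := fun t : d.-tuple R => tnth t i)).
    exact: measurable_tnth.
  exact: measurableT_comp.
under eq_fun do rewrite mxE.
apply: (measurableT_comp (f := fun t : d.-tuple R => tnth t i)) => //.
exact: measurable_tnth.
Qed.

Lemma measurable_neuronl x :
  measurable_fun setT (fun z : R * d.-tuple R => neuron z x).
Proof.
pose c z : (R * d.-tuple R) * d.-tuple R := (z, [tuple x ord0 i | i < d]).
rewrite (_ : (fun _ => _) =
    (fun p : (R * d.-tuple R) * d.-tuple R => neuron p.1 (row_of_tuple p.2)) \o c).
  apply: measurableT_comp; first exact: measurable_neuron.
  exact: measurable_fun_pair.
by apply/funext => z /=; rewrite row_of_tuple_surj.
Qed.

Lemma measurable_neuronr z :
  measurable_fun setT (fun t : d.-tuple R => neuron z (row_of_tuple t)).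
Proof.
pose c t : (R * d.-tuple R) * d.-tuple R := (z, t).
rewrite (_ : (fun _ => _) =
    (fun p : (R * d.-tuple R) * d.-tuple R => neuron p.1 (row_of_tuple p.2)) \o c)//.
apply: measurableT_comp; first exact: measurable_neuron.
exact: measurable_fun_pair.
Qed.

Lemma measurable_neuron_weight :
  measurable_fun setT (neuron_weight : R * d.-tuple R -> R).
Proof.
apply: measurable_funM; first by do 2 apply: measurableT_comp => //.
apply: measurable_sum => i; apply: measurableT_comp => //.
apply: (measurableT_comp (f := fun t : d.-tuple R => tnth t i)) => //.
exact: measurable_tnth.
Qed.

End Neuron.

(** If [f] exceeded [c] everywhere, monotonicity would force a mean of at least [c]. The strict
    inequality required here is later supplied by [M < K ^+ 2]. *)
Lemma exists_le_mean (disp : measure_display) (T : measurableType disp)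
    (R : realType) (P : probability T R) (f : T -> \bar R) (c : R) :
  (forall t, (0 <= f t)%E) -> (0 <= c)%R ->
  (\int[P]_t f t < c%:E)%E -> exists t, (f t <= c%:E)%E.
Proof.
move=> f0 c0 fc; apply: contrapT => /forallNP h.
move: fc; rewrite ltNge => /negP; apply.
rewrite -[leLHS]mule1 -(@probability_setT _ _ _ P) -integral_cst//.
apply: le_integral_nomeas => t /=; first by rewrite lee_fin.
by rewrite ltW// ltNge; apply/negP/h.
Qed.

(** * Moments of a neuron drawn from a Barron representation *)

Section BarronMean.
Context {R : realType} {d : nat}.
Variables (rho : probability (R * d.-tuple R)%type R) (M : R).
Hypothesis rhoM : barron_moment rho = M%:E.

Let mean_cst (c : R) : (\int[rho]_z c%:E = c%:E)%E.
Proof.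
rewrite integral_cst// -[RHS]mule1; congr (_ * _)%E.
exact: probability_setT.
Qed.

Let moment_weight : (\int[rho]_z (neuron_weight z ^+ 2)%:E = M%:E)%E.
Proof.
rewrite -rhoM; apply: eq_integral => z _.
by rewrite /neuron_weight exprMn real_normK ?num_real.
Qed.

Let integrable_weight2 :
  rho.-integrable setT (fun z => (neuron_weight z ^+ 2)%:E).
Proof.
apply/integrableP; split.
  apply/measurable_EFinP; apply: measurable_funX.
  exact: measurable_neuron_weight.
under eq_integral do rewrite gee0_abs ?lee_fin ?sqr_ge0//.
by rewrite moment_weight ltry.
Qed.

(** Replaces the Cauchy-Schwarz bound by the square root of [M]: once [M < K ^+ 2], the right-hand
    side is below [K]. *)
Lemma mean_neuron_weight_le (K : R) : 0 < K ->
  (\int[rho]_z (neuron_weight z)%:E <= ((M / K + K) / 2)%:E)%E.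
Proof.
move=> K0.
have -> : (M / K + K) / 2 = (2 * K)^-1 * M + K / 2 by field; exact: lt0r_neq0.
apply: (@le_trans _ _ (\int[rho]_z
    (((2 * K)^-1)%:E * (neuron_weight z ^+ 2)%:E + (K / 2)%:E))%E).
  apply: le_integral_nomeas => z; first by rewrite lee_fin neuron_weight_ge0.
  rewrite -EFinM -EFinD lee_fin.
  (* AM-GM: w <= (w^2 / K + K) / 2 *)
  rewrite -subr_ge0 [leRHS](_ : _ = (2 * K)^-1 * (neuron_weight z - K) ^+ 2).
    by rewrite mulr_ge0 ?sqr_ge0// invr_ge0; lra.
  by field; exact: lt0r_neq0.
rewrite integralD//; last 2 first.
- exact: integrableZl.
- exact: (@finite_measure_integrable_cst _ _ _ rho _ (K / 2)).
rewrite integralZl// moment_weight mean_cst.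
by rewrite -EFinM -EFinD.
Qed.

(** The deviation of the neuron from its mean [h] is centred, so no cross term with [A] survives,
    and its variance is at most the second moment [M]. *)
Lemma mean_neuron_sq_le (x : 'rV[R]_d) (h A : R) :
  (forall i, 0 <= x ord0 i <= 1) ->
  (\int[rho]_z (neuron z x)%:E = h%:E)%E ->
  (\int[rho]_z ((A + (neuron z x - h)) ^+ 2)%:E <= (A ^+ 2 + M)%:E)%E.
Proof.
move=> x01 xh.
have mn := @measurable_neuronl R d x.
have int1 : rho.-integrable setT (fun z => (neuron z x)%:E).
  apply: (@le_integrable _ _ _ _ _ measurableT _
    (fun z => ((neuron_weight z ^+ 2)%:E + 1%:E)%E)).
  - exact/measurable_EFinP.
  - move=> z _; rewrite -EFinD !abse_EFin lee_fin.
    apply: le_trans (neuron_cube z x01) _.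
    rewrite ger0_norm ?addr_ge0 ?sqr_ge0//.
    by have := neuron_weight_ge0 z; nra.
  - apply: integrableD => //.
    exact: (@finite_measure_integrable_cst _ _ _ rho _ 1).
have int2 : rho.-integrable setT (fun z => (neuron z x ^+ 2)%:E).
  apply: le_integrable integrable_weight2 => //.
    by apply/measurable_EFinP; exact: measurable_funX.
  move=> z _; rewrite !abse_EFin lee_fin !normrX ler_sqr ?nnegrE//.
  by rewrite (ger0_norm (neuron_weight_ge0 z)) neuron_cube.
have le2 : (\int[rho]_z (neuron z x ^+ 2)%:E <= M%:E)%E.
  rewrite -moment_weight; apply: le_integral_nomeas => z.
    by rewrite lee_fin sqr_ge0.
  rewrite lee_fin -[leLHS]real_normK ?num_real// ler_sqr ?nnegrE//.
    exact: neuron_cube.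
  exact: neuron_weight_ge0.
(* Expanding around [A - h] leaves only the mean of the neuron, which is [h], and the mean of its
   square. *)
rewrite (_ : (fun _ => _) = (fun z => ((A - h) ^+ 2)%:E +
    ((2 * (A - h))%:E * (neuron z x)%:E + (neuron z x ^+ 2)%:E))%E); last first.
  by apply/funext => z; rewrite -EFinM -!EFinD; congr EFin; ring.
rewrite integralD//; last 2 first.
- exact: (@finite_measure_integrable_cst _ _ _ rho _ ((A - h) ^+ 2)).
- by apply: integrableD => //; exact: integrableZl.
rewrite integralD//; last exact: integrableZl.
rewrite integralZl// xh mean_cst.
apply: (@le_trans _ _ (((A - h) ^+ 2)%:E + ((2 * (A - h))%:E * h%:E + M%:E))%E).
  by rewrite leeD2l// leeD2l.
by rewrite -EFinM -!EFinD lee_fin; nra.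
Qed.

End BarronMean.

(** * Greedy choice of neurons *)

Section GreedySampling.
Context {R : realType} {d : nat}.
Variables (S : set 'rV[R]_d) (h : 'rV[R]_d -> R).
Variables (rho : probability (R * d.-tuple R)%type R) (M K V : R).
Hypothesis mS : measurable ((@row_of_tuple R d) @^-1` S).
Hypothesis S01 : forall s, S s -> forall i, 0 <= s ord0 i <= 1.
Hypothesis mh : measurable_fun setT (fun t : d.-tuple R => h (row_of_tuple t)).
Hypothesis rhoM : barron_moment rho = M%:E.
Hypothesis rhoh :
  forall x, S x -> (\int[rho]_z (neuron z x)%:E)%E = (h x)%:E.
Hypothesis K0 : 0 < K.
Hypothesis MK : M < K ^+ 2.
Hypothesis volS : leb_vol S = V%:E.
Hypothesis V0 : 0 < V.

Let m1S : measurable_fun setT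
  (fun t : d.-tuple R => \1_S (row_of_tuple t) : R).
Proof. exact: (measurable_indic mS). Qed.

Let measurable_error (A : 'rV[R]_d -> R) :
  measurable_fun setT (fun t : d.-tuple R => A (row_of_tuple t)) ->
  measurable_fun setT (fun p : (R * d.-tuple R) * d.-tuple R =>
   (\1_S (row_of_tuple p.2) * (A (row_of_tuple p.2) +
     (neuron p.1 (row_of_tuple p.2) - h (row_of_tuple p.2))) ^+ 2)%:E).
Proof.
move=> mA; apply/measurable_EFinP; apply: measurable_funM.
  exact: (measurableT_comp m1S).
apply: measurable_funX; apply: measurable_funD.
  exact: (measurableT_comp mA).
apply: measurable_funB; first exact: measurable_neuron.
exact: (measurableT_comp mh).
Qed.

(** With the two integrals swapped, [mean_neuron_sq_le] applies at each point of [S]; off [S] the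
    indicator annihilates both sides. *)
Let mean_error_le (A : 'rV[R]_d -> R) :
  measurable_fun setT (fun t : d.-tuple R => A (row_of_tuple t)) ->
  (\int[rho]_z iint (fun v => (\1_S v * (A v + (neuron z v - h v)) ^+ 2)%:E)
    <= iint (fun v => (\1_S v * A v ^+ 2)%:E) + (M * V)%:E)%E.
Proof.
move=> mA.
have M0 : 0 <= M.
  rewrite -lee_fin -rhoM; apply: integral_ge0 => z _.
  by rewrite lee_fin mulr_ge0 ?sqr_ge0.
have err0 z v : (0 <= (\1_S v * (A v + (neuron z v - h v)) ^+ 2)%:E)%E.
  by rewrite lee_fin mulr_ge0 ?sqr_ge0.
rewrite iint_fubini//; last exact: measurable_error.
rewrite EFinM -volS /leb_vol -iintZl//; last exact/measurable_EFinP.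
rewrite -iintD//; last 4 first.
- by move=> v; rewrite lee_fin mulr_ge0 ?sqr_ge0.
- by move=> v; rewrite -EFinM lee_fin mulr_ge0.
- apply/measurable_EFinP; apply: measurable_funM => //.
  exact: measurable_funX.
- by apply: measurable_funeM; exact/measurable_EFinP.
apply: le_iint => v; first by apply: integral_ge0 => z _.
have [Sv|nSv] := boolP (v \in S); rewrite indicE ?(negbTE nSv) ?Sv.
  rewrite mulr1n mul1r mule1 -EFinD.
  under eq_integral do rewrite mul1r.
  by rewrite inE in Sv; apply: mean_neuron_sq_le => //; [exact: S01|exact: rhoh].
rewrite mulr0n mul0r mule0 adde0.
by under eq_integral do rewrite mul0r; rewrite integral0.
Qed.

(* Averaging over the next neuron does not increase the accumulated error by
   more than the second moment, because the cross term vanishes; adding the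
   weight to the averaged quantity controls the path norm simultaneously. *)
Lemma greedy_neurons n : exists zs : seq (R * d.-tuple R),
  size zs = n /\
  (iint (fun v => (\1_S v * (\sum_(z <- zs) (neuron z v - h v)) ^+ 2)%:E)
    + (K * V * \sum_(z <- zs) neuron_weight z)%:E
   <= (2 * n%:R * K ^+ 2 * V)%:E)%E.
Proof.
elim: n => [|n [zs [szs IH]]].
  exists [::]; split => //.
  rewrite (_ : (fun _ => _) = fun=> 0%E) ?iint0 ?big_nil ?mulr0 ?mul0r ?adde0//.
  by apply/funext => v; rewrite big_nil expr0n/= mulr0.
pose A (v : 'rV[R]_d) := \sum_(z <- zs) (neuron z v - h v).
pose W := \sum_(z <- zs) neuron_weight z.
have mA : measurable_fun setT (fun t : d.-tuple R => A (row_of_tuple t)).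
  apply: measurable_sum => z; apply: measurable_funB => //.
  exact: measurable_neuronr.
have W0 : 0 <= W by rewrite sumr_ge0// => z _; exact: neuron_weight_ge0.
pose E z := iint (fun v => (\1_S v * (A v + (neuron z v - h v)) ^+ 2)%:E).
pose L (z : R * d.-tuple R) : \bar R :=
  ((K * V * W)%:E + (K * V)%:E * (neuron_weight z)%:E)%E.
have KV0 : 0 <= K * V by rewrite mulr_ge0 ?ltW.
have E0 z : (0 <= E z)%E.
  by apply: iint_ge0 => v; rewrite lee_fin mulr_ge0 ?sqr_ge0.
have L0 z : (0 <= L z)%E.
  by rewrite /L -EFinM -EFinD lee_fin addr_ge0// mulr_ge0// neuron_weight_ge0.
have mE : measurable_fun setT E.
  apply: (@measurable_iint _ _ _ _
    (fun z v => (\1_S v * (A v + (neuron z v - h v)) ^+ 2)%:E)).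
    by move=> z v; rewrite lee_fin mulr_ge0 ?sqr_ge0.
  exact: measurable_error.
have mw : measurable_fun setT
    (fun z : R * d.-tuple R => (neuron_weight z)%:E).
  by apply/measurable_EFinP; exact: measurable_neuron_weight.
have mL : measurable_fun setT L.
  by apply: emeasurable_funD => //; exact: measurable_funeM.
(* On average one more neuron adds at most [M * V] to the error and [V * (M + K ^+ 2) / 2] to the
   scaled weight. Since [M < K ^+ 2], the total is strictly below [2 * K ^+ 2 * V]. *)
have : (\int[rho]_z (E z + L z) < (2 * n.+1%:R * K ^+ 2 * V)%:E)%E.
  rewrite ge0_integralD//.
  have -> : (\int[rho]_z L z =
      (K * V * W)%:E + (K * V)%:E * \int[rho]_z (neuron_weight z)%:E)%E.
    rewrite ge0_integralD//; last 3 first.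
    - by move=> z _; rewrite lee_fin mulr_ge0.
    - by move=> z _; rewrite -EFinM lee_fin mulr_ge0// neuron_weight_ge0.
    - exact: measurable_funeM.
    rewrite ge0_integralZl//; last by move=> z _; rewrite lee_fin neuron_weight_ge0.
    congr (_ + _)%E; rewrite integral_cst// -[RHS]mule1; congr (_ * _)%E.
    exact: probability_setT.
  apply: (@le_lt_trans _ _
    ((iint (fun v => (\1_S v * A v ^+ 2)%:E) + (M * V)%:E) +
     ((K * V * W)%:E + (K * V * ((M / K + K) / 2))%:E))%E).
    apply: leeD; first exact: mean_error_le.
    rewrite leeD2l// [leRHS]EFinM lee_wpmul2l ?lee_fin//.
    exact: mean_neuron_weight_le.
  rewrite addeACA.
  apply: (@le_lt_trans _ _ ((2 * n%:R * K ^+ 2 * V)%:E +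
     ((M * V)%:E + (K * V * ((M / K + K) / 2))%:E))%E).
    by rewrite leeD2r.
  rewrite -!EFinD lte_fin.
  have -> : K * V * ((M / K + K) / 2) = V * (M + K ^+ 2) / 2.
    by field; exact: lt0r_neq0.
  have : 0 < V * (K ^+ 2 - M) by rewrite mulr_gt0// subr_gt0.
  by rewrite -[n.+1%:R]natr1; lra.
case/exists_le_mean => [z||z zle].
- exact: adde_ge0.
- by rewrite mulr_ge0 ?(ltW V0)// mulr_ge0 ?sqr_ge0.
exists (z :: zs); split; first by rewrite /= szs.
rewrite big_cons mulrDr EFinD; apply: le_trans zle.
rewrite /L -EFinM [X in (_ <= _ + X)%E]addeC.
rewrite leeD2r//; apply: le_iint => v.
  by rewrite lee_fin mulr_ge0 ?sqr_ge0.
by rewrite big_cons addrC.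
Qed.

End GreedySampling.

(** * Approximation of a Barron function by m neurons *)

Section BarronApproximation.
Context {R : realType} {d : nat}.
Variables (S : set 'rV[R]_d) (h : 'rV[R]_d -> R).
Hypothesis mS : measurable ((@row_of_tuple R d) @^-1` S).
Hypothesis S01 : forall s, S s -> forall i, 0 <= s ord0 i <= 1.

(** On [S] the function is a parameter integral of a jointly measurable integrand, so Tonelli on the
    positive and negative parts gives measurability; off [S] the representation says nothing, hence
    the indicator. *)
Lemma barron_rep_measurable (rho : probability (R * d.-tuple R)%type R) :
  barron_rep S h rho ->
  measurable_fun setT (fun t : d.-tuple R =>
    \1_S (row_of_tuple t) * h (row_of_tuple t)).
Proof.
move=> [_ rhoh].
pose f (p : (R * d.-tuple R) * d.-tuple R) : \bar R :=
  (neuron p.1 (row_of_tuple p.2))%:E.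
have mf : measurable_fun setT f.
  by apply/measurable_EFinP; exact: measurable_neuron.
pose F (t : d.-tuple R) : \bar R := (\int[rho]_z f (z, t))%E.
have mF : measurable_fun setT F.
  have mG (g : (R * d.-tuple R) * d.-tuple R -> \bar R) :
      measurable_fun setT g -> (forall p, (0 <= g p)%E) ->
      measurable_fun setT (fun t => \int[rho]_z g (z, t))%E.
    by move=> mg g0; have := @measurable_fun_fubini_tonelli_G _ _ _ _ R rho g mg g0.
  have m1 := mG (f^\+)%E (measurable_funepos mf) (funepos_ge0 f).
  have m2 := mG (f^\-)%E (measurable_funeneg mf) (funeneg_ge0 f).
  rewrite (_ : F = fun t => (\int[rho]_z f^\+ (z, t) - \int[rho]_z f^\- (z, t))%E).
    exact: (emeasurable_funB m1 m2).
  apply/funext => t; rewrite /F integralE; congr (_ - _)%E;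
    by apply: eq_integral => z _; rewrite ?funeposE ?funenegE.
rewrite (_ : (fun _ => _) = (fun t => \1_S (row_of_tuple t) * fine (F t))).
  apply: measurable_funM; first exact: (measurable_indic mS).
  exact: (measurableT_comp (f := @fine R)).
apply/funext => t; have [St|nSt] := boolP (row_of_tuple t \in S).
  congr (_ * _); rewrite inE in St.
  by rewrite /F /f /= (rhoh _ St).
by rewrite indicE (negbTE nSt) !mul0r.
Qed.

Lemma barron_norm_ge0 : 0 <= barron_norm S h.
Proof.
rewrite /barron_norm; set E := [set _ | _ in _].
have [->|/set0P E0] := eqVneq E set0; first by rewrite inf0.
by apply: lb_le_inf => // _ [rho _ <-].
Qed.

Lemma barron_norm_lt (K : R) : in_barron S h -> barron_norm S h < K ->
  exists rho M, [/\ barron_rep S h rho, barron_moment rho = M%:E & M < K ^+ 2].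
Proof.
move=> [rho0 rho0P] /inf_lt[|_ [rho rhoP <-] rhoK].
  by exists (Num.sqrt (fine (barron_moment rho0))); exists rho0.
have mom0 : (0 <= barron_moment rho)%E.
  by apply: integral_ge0 => z _; rewrite lee_fin mulr_ge0 ?sqr_ge0.
exists rho, (fine (barron_moment rho)); split => //.
  by rewrite fineK// ge0_fin_numE//; case: rhoP.
have f0 := fine_ge0 mom0.
by rewrite -[ltLHS]sqr_sqrtr// ltr_pXn2r ?nnegrE// (le_trans _ (ltW rhoK)).
Qed.

(** The value at [x] is at most the mean weight, which near-optimal representations make arbitrarily
    small. This case must be separate: for norm 0, no moment lies strictly below the square of twice
    the norm. *)
Lemma barron_norm0_eq0 (x : 'rV[R]_d) :
  in_barron S h -> barron_norm S h = 0 -> S x -> h x = 0.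
Proof.
move=> Bh h0 Sx.
suff hK (K : R) : 0 < K -> `|h x| <= K.
  apply/eqP; rewrite -normr_le0 leNgt; apply/negP => hx0.
  have /hK : 0 < `|h x| / 2 by rewrite divr_gt0.
  by rewrite leNgt ltr_pdivrMr// mulr_natr mulr2n ltrDl hx0.
move=> K0; have [|rho [M [[_ rhoh] rhoM MK]]] := @barron_norm_lt K Bh.
  by rewrite h0.
rewrite -lee_fin -abse_EFin -(rhoh x Sx).
have mn := @measurable_neuronl R d x.
apply: le_trans (le_abse_integral _ measurableT _) _.
  exact/measurable_EFinP.
apply: (@le_trans _ _ (\int[rho]_z (neuron_weight z)%:E)%E).
  apply: le_integral_nomeas => z; first exact: abse_ge0.
  by rewrite abse_EFin lee_fin; apply: neuron_cube; exact: S01.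
apply: le_trans (mean_neuron_weight_le rhoM K0) _.
rewrite lee_fin ler_pdivrMr// mulr_natr mulr2n lerD2r ler_pdivrMr//.
by rewrite ltW.
Qed.

(** With B the Barron norm, the greedy bound is used for K = 2B. The error 2 m K^2 V divided by m^2
    gives 8 B^2 V / m, and K V times the total weight being at most 2 m K^2 V gives an average
    weight of at most 2K = 4B. *)
Lemma barron_approx (V : R) (m : nat) :
  leb_vol S = V%:E -> 0 < V -> in_barron S h -> (0 < m)%N ->
  exists zs : seq (R * d.-tuple R), [/\ size zs = m,
   (iint (fun v =>
       (\1_S v * (m%:R^-1 * \sum_(z <- zs) neuron z v - h v) ^+ 2)%:E)
    <= (8 * barron_norm S h ^+ 2 / m%:R * V)%:E)%E &
   m%:R^-1 * \sum_(z <- zs) neuron_weight z <= 4 * barron_norm S h].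
Proof.
move=> volS V0 Bh m0.
have m0R : 0 < m%:R :> R by rewrite ltr0n.
have [B0|B0] := eqVneq (barron_norm S h) 0.
  exists (nseq m (0, [tuple 0 | _ < d])); split; first by rewrite size_nseq.
    rewrite (_ : (fun _ => _) = fun=> 0%E).
      by rewrite iint0 B0 expr0n/= mulr0 !mul0r.
    apply/funext => v; have [vS|nvS] := boolP (v \in S); last first.
      by rewrite indicE (negbTE nvS) mul0r.
    have -> : h v = 0 by apply: barron_norm0_eq0 => //; move: vS; rewrite inE.
    rewrite big1_seq ?mulr0 ?subr0 ?expr0n/= ?mulr0//.
    by move=> z /= /nseqP[-> _]; rewrite /neuron mul0r.
  rewrite B0 mulr0 big1_seq ?mulr0// => z /= /nseqP[-> _].
  by rewrite /neuron_weight normr0 mul0r.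
have {}B0 : 0 < barron_norm S h by rewrite lt_neqAle eq_sym B0 barron_norm_ge0.
set B := barron_norm S h in B0 *.
have [|rho [M [rhoP rhoM MK]]] := @barron_norm_lt (2 * B) Bh.
  by rewrite -/B; lra.
(* The greedy choice needs a target measurable on the whole space; this truncation is, and agrees
   with [h] on [S]. *)
pose h' v := \1_S v * h v.
have rhoh' x : S x -> (\int[rho]_z (neuron z x)%:E)%E = (h' x)%:E.
  move=> Sx; rewrite [LHS](rhoP.2 x Sx) /h' indicE.
  by rewrite (_ : x \in S) ?inE// mul1r.
have K0 : 0 < 2 * B by lra.
have mh' := barron_rep_measurable rhoP.
have [zs [szs zsP]] := greedy_neurons mS S01 mh' rhoM rhoh' K0 MK volS V0 m.
exists zs; split => //.
  rewrite (_ : (fun _ => _) = fun v => ((m%:R ^- 2)%:E *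
      (\1_S v * (\sum_(z <- zs) (neuron z v - h' v)) ^+ 2)%:E)%E); last first.
    apply/funext => v; rewrite -EFinM; congr EFin.
    have [vS|nvS] := boolP (v \in S); last first.
      by rewrite indicE (negbTE nvS) !mul0r mulr0.
    rewrite /h' !indicE vS !mul1r big_split /= sumrN big_const_seq count_predT.
    rewrite iter_addr_0 szs -mulr_natr; field; exact: lt0r_neq0.
  rewrite iintZl//; last 2 first.
  - by move=> v; rewrite lee_fin mulr_ge0 ?sqr_ge0.
  - apply/measurable_EFinP; apply: measurable_funM.
      exact: (measurable_indic mS).
    apply: measurable_funX; apply: measurable_sum => z.
    by apply: measurable_funB => //; exact: measurable_neuronr.
  rewrite (_ : 8 * B ^+ 2 / m%:R * V =
      m%:R ^- 2 * (2 * m%:R * (2 * B) ^+ 2 * V)); last first.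
    by field; exact: lt0r_neq0.
  rewrite [leRHS]EFinM lee_wpmul2l ?lee_fin ?invr_ge0 ?sqr_ge0//.
  apply: le_trans zsP; rewrite leeDl// lee_fin mulr_ge0//.
    by rewrite mulr_ge0// ltW.
  by rewrite sumr_ge0// => z _; exact: neuron_weight_ge0.
have : ((2 * B * V * \sum_(z <- zs) neuron_weight z)%:E <=
    (2 * m%:R * (2 * B) ^+ 2 * V)%:E)%E.
  apply: le_trans zsP; rewrite leeDr//.
  by apply: iint_ge0 => v; rewrite lee_fin mulr_ge0 ?sqr_ge0.
have KV0 : 0 < 2 * B * V by rewrite mulr_gt0.
rewrite lee_fin => h1; rewrite [leLHS]mulrC ler_pdivrMr//.
rewrite -(ler_pM2l KV0); apply: (le_trans h1).
by rewrite le_eqVlt; apply/orP; left; apply/eqP; ring.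
Qed.

End BarronApproximation.

(** * Residual networks as lists of neurons *)

Section FunctionalNetwork.
Context {R : realType} {T : finType}.
Implicit Types (s : seq ((T -> R) * (T -> R))) (h : T -> R).

(* A layer is a list of neurons (w, o): w holds the input weights (a row of W)
   and o the output weights (a column of U). *)
Definition layer_step s h : T -> R :=
  fun t => h t + \sum_(p <- s) p.2 t * relu (\sum_t' p.1 t' * h t').

(** The matrix I + 3|U||W| of the layer acting on a column, in the same shape as [layer_step]. *)
Definition layer_path s h : T -> R :=
  fun t => h t + 3 * \sum_(p <- s) `|p.2 t| * (\sum_t' `|p.1 t'| * h t').

Definition zero_neuron : (T -> R) * (T -> R) := (fun=> 0, fun=> 0).

(** Layers narrower than the common width are filled up with zero neurons, which change neither the
    value nor the path norm. *)
Lemma sum_nth_pad s (m : nat) (F : (T -> R) * (T -> R) -> R) :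
  (size s <= m)%N -> F zero_neuron = 0 ->
  \sum_(k < m) F (nth zero_neuron s k) = \sum_(p <- s) F p.
Proof.
move=> sm F0; rewrite (big_nth zero_neuron) big_mkord.
rewrite (big_ord_widen m (fun k => F (nth zero_neuron s k)) sm).
rewrite [RHS]big_mkcond; apply: eq_bigr => k _.
by case: ltnP => // sk; rewrite nth_default.
Qed.

Lemma sum_enum_val (F : T -> R) : \sum_(i < #|T|) F (enum_val i) = \sum_t F t.
Proof. by rewrite [RHS](reindex _ (onW_bij _ (@enum_val_bij T))). Qed.

Definition col_of_fun h : 'cV[R]_#|T| := \col_i h (enum_val i).

Definition net_of_layers d m L (u : T -> R) (V : T -> 'I_d -> R)
    (layers : nat -> seq ((T -> R) * (T -> R))) : resnet R d m #|T| L :=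
  ResNet (col_of_fun u) (\matrix_(i, j) V (enum_val i) j)
    (fun l => \matrix_(k, i) (nth zero_neuron (layers l) k).1 (enum_val i))
    (fun l => \matrix_(i, k) (nth zero_neuron (layers l) k).2 (enum_val i)).

Section Realization.
Variables (d m L : nat) (u : T -> R) (V : T -> 'I_d -> R).
Variable layers : nat -> seq ((T -> R) * (T -> R)).
Hypothesis sizeL : forall l, (l < L)%N -> (size (layers l) <= m)%N.
Let th : resnet R d m #|T| L := net_of_layers m L u V layers.

Lemma rn_eval_net (x : 'rV[R]_d) :
  rn_eval th x = \sum_t u t *
    foldl (fun h l => layer_step (layers l) h)
      (fun t => \sum_j V t j * x ord0 j) (iota 0 L) t.
Proof.
have step (l : 'I_L) h : col_of_fun h +
    rn_U th l *m relu_mx (rn_W th l *m col_of_fun h) =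
    col_of_fun (layer_step (layers l) h).
  apply/colP => i; rewrite !mxE; congr (_ + _).
  rewrite -(sum_nth_pad (sizeL (ltn_ord l))
    (F := fun p => p.2 (enum_val i) * relu (\sum_t' p.1 t' * h t'))); last first.
    by rewrite mul0r.
  apply: eq_bigr => k _; rewrite !mxE; congr (_ * relu _).
  rewrite -sum_enum_val; apply: eq_bigr => j _; by rewrite !mxE.
have fold (s : seq 'I_L) h :
    foldl (fun c l => c + rn_U th l *m relu_mx (rn_W th l *m c)) (col_of_fun h) s =
    col_of_fun (foldl (fun h l => layer_step (layers l) h) h (map val s)).
  by elim: s h => [//|l s IH] h; rewrite /= step IH.
rewrite /rn_eval /rn_hidden.
have -> : rn_V th *m x^T = col_of_fun (fun t => \sum_j V t j * x ord0 j).
  by apply/colP => i; rewrite !mxE; apply: eq_bigr => j _; rewrite !mxE.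
rewrite fold val_enum_ord mxE -sum_enum_val.
by apply: eq_bigr => i _; rewrite !mxE.
Qed.

(** All entries of the row are nonnegative, so its l1 norm is its pairing with the all-ones vector.
    Associating the product from the right turns it into a forward pass that starts from the row
    sums of |V|. *)
Lemma path_norm_net :
  path_norm th = \sum_t `|u t| *
    foldl (fun h l => layer_path (layers l) h)
      (fun t => \sum_j `|V t j|) (iota 0 L) t.
Proof.
pose M (l : 'I_L) : 'M[R]_#|T| :=
  1%:M + 3%:R *: (abs_mx (rn_U th l) *m abs_mx (rn_W th l)).
have M0 l i j : 0 <= M l i j.
  rewrite !mxE addr_ge0 ?mulr_ge0 ?sumr_ge0// => k _.
  by rewrite !mxE mulr_ge0.
have step l h : M l *m col_of_fun h = col_of_fun (layer_path (layers l) h).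
  rewrite mulmxDl mul1mx -scalemxAl -mulmxA.
  apply/colP => i; rewrite !mxE; congr (_ + _ * _).
  rewrite -(sum_nth_pad (sizeL (ltn_ord l))
    (F := fun p => `|p.2 (enum_val i)| * (\sum_t' `|p.1 t'| * h t'))); last first.
    by rewrite normr0 mul0r.
  apply: eq_bigr => k _; rewrite !mxE; congr (_ * _).
  rewrite -sum_enum_val; apply: eq_bigr => j _; by rewrite !mxE.
have fold (s : seq 'I_L) (r : 'rV[R]_#|T|) h :
    foldr (fun l acc => acc *m M l) r s *m col_of_fun h =
    r *m col_of_fun (foldl (fun h l => layer_path (layers l) h) h (map val s)).
  by elim: s h => [//|l s IH] h; rewrite /= -mulmxA step IH.
have row0 (s : seq 'I_L) (r : 'rV[R]_#|T|) : (forall j, 0 <= r ord0 j) ->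
    forall j, 0 <= (foldr (fun l acc => acc *m M l) r s) ord0 j.
  move=> r0; elim: s => [//|l s IH] j /=.
  by rewrite mxE sumr_ge0// => k _; rewrite mulr_ge0.
rewrite /path_norm -/M; set row := foldr _ _ _.
have row_ge0 j : 0 <= row ord0 j by apply: row0 => k; rewrite !mxE.
under eq_bigr => j _.
  rewrite ger0_norm; last first.
    by rewrite mxE sumr_ge0// => k _; rewrite !mxE mulr_ge0.
  over.
transitivity ((row *m col_of_fun (fun t => \sum_j `|V t j|)) ord0 ord0).
  rewrite mxE; under eq_bigr do rewrite mxE.
  rewrite exchange_big; apply: eq_bigr => i _ /=.
  by rewrite mxE mulr_sumr; apply: eq_bigr => j _; rewrite !mxE.
rewrite /row fold val_enum_ord mxE -sum_enum_val.
by apply: eq_bigr => i _; rewrite !mxE.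
Qed.

End Realization.
End FunctionalNetwork.

(** * The maximum of 2^alpha values as a residual network *)

Section Tournament.
Context {R : realType}.
Implicit Types (c p : nat -> R) (k n b : nat).

(** Winners move to the first [2 ^ k] slots; the later slots keep stale values that no subsequent
    round reads. *)
Definition max_round k c : nat -> R :=
  fun b => if (b < 2 ^ k)%N then Num.max (c b) (c (b + 2 ^ k)%N) else c b.

(** Path weights of the update [c b + relu (c (b + 2 ^ k) - c b)]: the skip connection passes [p b],
    and the neuron reads both slots with absolute weight 1, multiplied by 3. *)
Definition path_round k p : nat -> R :=
  fun b => if (b < 2 ^ k)%N then p b + 3 * (p (b + 2 ^ k)%N + p b) else p b.

Definition is_max n c (y : R) : Prop :=
  (forall b, (b < n)%N -> c b <= y) /\ exists2 b, (b < n)%N & c b = y.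

Lemma is_max_round k c y :
  is_max (2 ^ k.+1) c y -> is_max (2 ^ k) (max_round k c) y.
Proof.
rewrite expnS mul2n -addnn => -[cy [b bk cb]]; split.
  move=> i ik; rewrite /max_round ik ge_max !cy//; first by rewrite ltn_add2r.
  exact: ltn_addr.
have [bk'|bk'] := ltnP b (2 ^ k).
  exists b => //; rewrite /max_round bk' cb; apply/max_idPl.
  by apply: cy; rewrite ltn_add2r.
have bk2 : (b - 2 ^ k < 2 ^ k)%N by rewrite ltn_subLR.
exists (b - 2 ^ k)%N => //; rewrite /max_round bk2 subnK// cb.
by apply/max_idPr; apply: cy; exact: ltn_addr.
Qed.

Lemma is_max_maxA alpha (F : 'I_(2 ^ alpha) -> R) c :
  (forall i : 'I_(2 ^ alpha), c i = F i) -> is_max (2 ^ alpha) c (Defs.maxA F).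
Proof.
move=> cF; split.
  by move=> b bN; rewrite (cF (Ordinal bN)) /Defs.maxA; exact: le_bigmax.
rewrite /Defs.maxA; elim/big_ind: _ => [|x y [b bN <-] [b' bN' <-]|i _].
- by exists 0%N; [exact: pow2_gt0|exact: (cF (act0 alpha))].
- by rewrite maxEle; case: ifP => _; [exists b'|exists b].
- by exists i.
Qed.

(** A slot below [2 ^ k] is counted 1 + 3 times and its partner 3 times, whence the factor 4. *)
Lemma sum_path_round k p : (forall b, 0 <= p b) ->
  \sum_(0 <= b < 2 ^ k) path_round k p b <=
  4 * \sum_(0 <= b < 2 ^ k.+1) p b.
Proof.
move=> p0; rewrite expnS mul2n -addnn
  [X in _ <= 4 * X](@big_cat_nat _ _ _ (2 ^ k)) ?leq_addr//=.
rewrite (_ : \sum_(2 ^ k <= b < 2 ^ k + 2 ^ k) p b =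
    \sum_(0 <= b < 2 ^ k) p (b + 2 ^ k)%N); last first.
  by rewrite -{1}[(2 ^ k)%N]add0n big_addn addnK.
rewrite -big_split mulr_sumr !big_mkord; apply: ler_sum => i _.
rewrite /path_round ltn_ord /=; have := p0 (i + 2 ^ k)%N; have := p0 i; lra.
Qed.

Lemma path_round_ge0 k p :
  (forall b, 0 <= p b) -> forall b, 0 <= path_round k p b.
Proof.
by move=> p0 b; rewrite /path_round; case: ifP => _;
  rewrite ?addr_ge0 ?mulr_ge0 ?addr_ge0.
Qed.

Lemma iota_rcons n : iota 1 n.+1 = rcons (iota 1 n) n.+1.
Proof. by rewrite -[in LHS](addn1 n) iotaD cats1 add1n. Qed.

(** After n rounds the maximum is attained among the first [2 ^ (alpha - n)] slots, so finally in
    slot 0. Rounds are numbered from 1 because layer 0 will hold the two-layer networks. *)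
Lemma tournament_max alpha c y : is_max (2 ^ alpha) c y ->
  foldl (fun c l => max_round (alpha - l) c) c (iota 1 alpha) 0%N = y.
Proof.
move=> cy; suff H n : (n <= alpha)%N -> is_max (2 ^ (alpha - n))
    (foldl (fun c l => max_round (alpha - l) c) c (iota 1 n)) y.
  have := H alpha (leqnn _); rewrite subnn expn0 => -[_ [[|b]]] //.
elim: n => [|n IH] na; first by rewrite subn0.
rewrite iota_rcons foldl_rcons; apply: is_max_round.
by rewrite -subSn// subSS; apply: IH; exact: ltnW.
Qed.

Lemma tournament_path alpha p : (forall b, 0 <= p b) ->
  foldl (fun p l => path_round (alpha - l) p) p (iota 1 alpha) 0%N
    <= 4 ^+ alpha * \sum_(0 <= b < 2 ^ alpha) p b.
Proof.
move=> p0; pose q n := foldl (fun p l => path_round (alpha - l) p) p (iota 1 n).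
have q0 n b : 0 <= q n b.
  elim: n b => [//|n IH] b; rewrite /q iota_rcons foldl_rcons.
  exact: path_round_ge0.
suff H n : (n <= alpha)%N -> \sum_(0 <= b < 2 ^ (alpha - n)) q n b <=
    4 ^+ n * \sum_(0 <= b < 2 ^ alpha) p b.
  by have := H alpha (leqnn _); rewrite subnn expn0 big_nat1.
elim: n => [|n IH] na; first by rewrite subn0 mul1r.
rewrite [q n.+1](_ : _ = path_round (alpha - n.+1) (q n)); last first.
  by rewrite /q iota_rcons foldl_rcons.
apply: le_trans (sum_path_round _ (q0 n)) _.
rewrite -subSn// subSS exprS -mulrA ler_wpM2l//; apply: IH; exact: ltnW.
Qed.

End Tournament.

(** * Tournament rounds as network layers *)

Section MaxNetwork.
Context {R : realType} {d alpha : nat}.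
Let N := (2 ^ alpha)%N.

(* One coordinate per input, one that keeps the two-layer network of the given
   action, and one per action on which the maximum is computed. *)
Definition max_state := ('I_d + option 'I_(2 ^ alpha))%type.

Definition state (x : 'I_d -> R) (y : R) (c : nat -> R) : max_state -> R :=
  fun t => match t with inl i => x i | inr None => y | inr (Some b) => c b end.

Lemma sum_state (G : max_state -> R) :
  \sum_t G t = \sum_i G (inl i) + (G (inr None) + \sum_b G (inr (Some b))).
Proof.
rewrite big_sumType /=; congr (_ + _).
rewrite [LHS](bigD1 None)//=; congr (_ + _).
pose F (o : option 'I_(2 ^ alpha)) := if o is Some b then b else act0 alpha.
rewrite (reindex_onto Some F)/=; last by case.
by apply: eq_bigl => b; rewrite eqxx.
Qed.

Lemma sum_delta_nat (c : nat -> R) b : (b < N)%N ->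
  \sum_(i < N) (val i == b)%:R * c i = c b.
Proof.
move=> bN; rewrite (bigD1 (Ordinal bN))//= eqxx mul1r big1 ?addr0// => i.
by rewrite -val_eqE /= => /negbTE ->; rewrite mul0r.
Qed.

(** Neuron b reads the partner slot minus its own slot and writes the rectified gain back to its own
    slot. *)
Definition round_layer k : seq ((max_state -> R) * (max_state -> R)) :=
  [seq (state (fun=> 0) 0 (fun i => (i == (b + 2 ^ k)%N)%:R - (i == b)%:R),
        state (fun=> 0) 0 (fun i => (i == b)%:R)) | b <- iota 0 (2 ^ k)].

Lemma round_layer_sum k (F : nat -> R) (b : nat) :
  \sum_(i <- iota 0 (2 ^ k)) (b == i)%:R * F i =
  if (b < 2 ^ k)%N then F b else 0.
Proof.
rewrite (_ : iota 0 (2 ^ k) = index_iota 0 (2 ^ k)); last first.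
  by rewrite /index_iota subn0.
rewrite big_mkord; case: ltnP => bk.
  rewrite (bigD1 (Ordinal bk))//= eqxx mul1r big1 ?addr0// => i.
  by rewrite -val_eqE /= eq_sym => /negbTE ->; rewrite mul0r.
rewrite big1// => i _; rewrite gtn_eqF ?mul0r//.
exact: leq_trans (ltn_ord i) bk.
Qed.

Lemma step_round k x y c : (k < alpha)%N ->
  layer_step (round_layer k) (state x y c) = state x y (max_round k c).
Proof.
move=> ka.
have kN b : (b < 2 ^ k)%N -> (b + 2 ^ k < N)%N.
  move=> bk; apply: (@leq_trans (2 ^ k.+1)); last by rewrite leq_exp2l.
  by rewrite expnS mul2n -addnn ltn_add2r.
apply/funext => t; rewrite /layer_step /round_layer big_map.
under eq_big_seq => b.
  rewrite mem_iota add0n => /= bk; rewrite sum_state.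
  rewrite big1 ?add0r; last by move=> i _; rewrite mul0r.
  rewrite mul0r add0r.
  under eq_bigr do rewrite /= mulrBl.
  rewrite sumrB !sum_delta_nat ?kN//;
    last exact: leq_ltn_trans (leq_addr _ _) (kN b bk).
  over.
case: t => [i|[b|]] /=.
- by rewrite big1 ?addr0// => b _; rewrite mul0r.
- rewrite (round_layer_sum k (fun b0 => relu (c (b0 + 2 ^ k)%N - c b0))).
  rewrite /max_round; case: ifP => _; last by rewrite addr0.
  rewrite /relu !maxEle subr_le0.
  case: (leP (c (b + 2 ^ k)%N) (c b)) => [le1|lt1].
    rewrite addr0; case: ifP => // le2.
    by apply/eqP; rewrite eq_le le1 le2.
  by rewrite (ltW lt1) addrC subrK.
- by rewrite big1 ?addr0// => b _; rewrite mul0r.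
Qed.

Lemma path_round_layer k x y p : (k < alpha)%N ->
  layer_path (round_layer k) (state x y p) = state x y (path_round k p).
Proof.
move=> ka.
have kN b : (b < 2 ^ k)%N -> (b + 2 ^ k < N)%N.
  move=> bk; apply: (@leq_trans (2 ^ k.+1)); last by rewrite leq_exp2l.
  by rewrite expnS mul2n -addnn ltn_add2r.
apply/funext => t; rewrite /layer_path /round_layer big_map.
under eq_big_seq => b.
  rewrite mem_iota add0n => /= bk; rewrite sum_state.
  rewrite big1 ?add0r; last by move=> i _; rewrite normr0 mul0r.
  rewrite normr0 mul0r add0r.
  (* The two indicators have disjoint supports, as b differs from b + 2^k, so the absolute value of
     their difference is their sum. *)
  under eq_bigr => i _.
    rewrite /= (_ : `|_| =
        ((i : nat) == (b + 2 ^ k)%N)%:R + ((i : nat) == b)%:R); last first.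
      have [->|ib] := eqVneq (i : nat) b.
        have -> : (b == b + 2 ^ k)%N = false.
          by apply/negbTE; rewrite neq_ltn -{1}[b]addn0 ltn_add2l expn_gt0.
        by rewrite !(mulr0n, mulr1n) sub0r normrN normr1 add0r.
      by rewrite subr0 addr0 normr_nat.
    rewrite mulrDl; over.
  rewrite big_split /= !sum_delta_nat ?kN//;
    last exact: leq_ltn_trans (leq_addr _ _) (kN b bk).
  over.
case: t => [i|[b|]] /=.
- by rewrite big1 ?mulr0 ?addr0// => b _; rewrite normr0 mul0r.
- under eq_bigr do rewrite normr_nat.
  rewrite (round_layer_sum k (fun b0 => p (b0 + 2 ^ k)%N + p b0)).
  by rewrite /path_round; case: ifP => _; rewrite ?mulr0 ?addr0.
- by rewrite big1 ?mulr0 ?addr0// => b _; rewrite normr0 mul0r.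
Qed.

End MaxNetwork.

(** * The network of one action *)

Section MaxNetworkRealization.
Context {R : realType} {d alpha : nat}.
Variables (zs : 'I_(2 ^ alpha) -> seq (R * d.-tuple R)) (c : R).
Hypothesis c0 : 0 <= c.

Definition two_layer (b : 'I_(2 ^ alpha)) (x : 'rV[R]_d) : R :=
  c * \sum_(z <- zs b) neuron z x.

Definition two_layer_weight (b : 'I_(2 ^ alpha)) : R :=
  c * \sum_(z <- zs b) neuron_weight z.

Definition extend_ord (F : 'I_(2 ^ alpha) -> R) (n : nat) : R :=
  if insub n is Some b then F b else 0.

Lemma extend_ordE F (b : 'I_(2 ^ alpha)) : extend_ord F b = F b.
Proof. by rewrite /extend_ord valK. Qed.

Lemma two_layer_weight_ge0 b : 0 <= two_layer_weight b.
Proof.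
by rewrite mulr_ge0 ?sumr_ge0// => z _; exact: neuron_weight_ge0.
Qed.

Lemma two_layer_lipschitz b x y :
  `|two_layer b x - two_layer b y| <= two_layer_weight b * linf_dist x y.
Proof.
rewrite /two_layer /two_layer_weight -mulrBr normrM (ger0_norm c0) -mulrA.
rewrite ler_wpM2l// -sumrB mulr_suml.
apply: le_trans (ler_norm_sum _ _ _) _; apply: ler_sum => z _.
exact: neuron_lipschitz.
Qed.

(** The neurons of all actions are needed for the maximum. Those of [a] write twice: the tournament
    may overwrite slot [a], whereas the extra coordinate survives to the output. *)
Definition first_layer (a : 'I_(2 ^ alpha)) :
    seq ((@max_state d alpha -> R) * (@max_state d alpha -> R)) :=
  [seq (state (tnth z.2) 0 (fun=> 0),
        state (fun=> 0) ((b == a)%:R * (c * z.1))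
          (fun n => (n == b)%:R * (c * z.1)))
  | b <- enum 'I_(2 ^ alpha), z <- zs b].

Lemma sum_first_layer (G : 'I_(2 ^ alpha) -> R) a :
  \sum_(b : 'I_(2 ^ alpha)) (b == a)%:R * G b = G a.
Proof.
rewrite (bigD1 a)//= eqxx mul1r big1 ?addr0// => b /negbTE ->.
by rewrite mul0r.
Qed.

Lemma step_first a (x : 'rV[R]_d) :
  layer_step (first_layer a) (state (x ord0) 0 (fun=> 0)) =
  state (x ord0) (two_layer a x) (extend_ord (fun b => two_layer b x)).
Proof.
have dot (z : R * d.-tuple R) :
    \sum_(t : max_state) state (alpha := alpha) (tnth z.2) 0 (fun=> 0) t *
      state (x ord0) 0 (fun=> 0) t = tdot z.2 x.
  rewrite sum_state /= mul0r add0r [X in _ + X]big1 ?addr0//.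
apply/funext => t; rewrite /layer_step big_allpairs_dep big_enum /=.
under eq_bigr => b _ do under eq_bigr => z _ do rewrite dot.
case: t => [i|[b'|]] /=.
- rewrite big1 ?addr0// => b _; rewrite big1// => z _; exact: mul0r.
- rewrite add0r extend_ordE -[RHS](sum_first_layer (fun b => two_layer b x)).
  apply: eq_bigr => b _; rewrite /two_layer !mulr_sumr.
  apply: eq_bigr => z _; rewrite /neuron -!mulrA; congr (_%:R * _).
  by rewrite eq_sym.
- rewrite add0r -[RHS](sum_first_layer (fun b => two_layer b x)).
  apply: eq_bigr => b _; rewrite /two_layer !mulr_sumr.
  by apply: eq_bigr => z _; rewrite /neuron -!mulrA.
Qed.

(** The initial path weights are 1 on the inputs because [V] will copy each input into its own
    coordinate. *)
Lemma path_first a :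
  layer_path (first_layer a) (state (fun=> 1) 0 (fun=> 0)) =
  state (fun=> 1) (3 * two_layer_weight a)
    (extend_ord (fun b => 3 * two_layer_weight b)).
Proof.
have dot (z : R * d.-tuple R) :
    \sum_(t : max_state) `|state (alpha := alpha) (tnth z.2) 0 (fun=> 0) t| *
      state (fun=> 1) 0 (fun=> 0) t = tnorm1 z.2.
  rewrite sum_state /= mulr0 add0r [X in _ + X]big1 ?addr0//.
  by apply: eq_bigr => i _; rewrite mulr1.
apply/funext => t; rewrite /layer_path big_allpairs_dep big_enum /=.
under eq_bigr => b _ do under eq_bigr => z _ do rewrite dot.
case: t => [i|[b'|]] /=.
- rewrite big1 ?mulr0 ?addr0// => b _; rewrite big1// => z _.
  by rewrite normr0 mul0r.
- rewrite add0r extend_ordE; congr (_ * _).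
  rewrite -[RHS](sum_first_layer two_layer_weight).
  apply: eq_bigr => b _; rewrite /two_layer_weight !mulr_sumr.
  apply: eq_bigr => z _; rewrite /neuron_weight !normrM normr_nat (ger0_norm c0).
  by rewrite -!mulrA; congr (_%:R * _); rewrite eq_sym.
- rewrite add0r; congr (_ * _).
  rewrite -[RHS](sum_first_layer two_layer_weight).
  apply: eq_bigr => b _; rewrite /two_layer_weight !mulr_sumr.
  apply: eq_bigr => z _; rewrite /neuron_weight !normrM normr_nat (ger0_norm c0).
  by rewrite -!mulrA.
Qed.

Definition max_layers a (l : nat) :=
  if l is 0 then first_layer a
  else round_layer (d := d) (alpha := alpha) (alpha - l).

Lemma step_rounds a x y q :
  foldl (fun h l => layer_step (max_layers a l) h) (state x y q) (iota 1 alpha) =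
  state x y (foldl (fun q l => max_round (alpha - l) q) q (iota 1 alpha)).
Proof.
(* Bounds kept for the induction on the list: only layers with positive index are rounds, and their
   exponent [alpha - l] must stay below [alpha]. *)
have : all (fun l => 0 < l <= alpha)%N (iota 1 alpha).
  by apply/allP => l; rewrite mem_iota add1n ltnS.
elim: (iota 1 alpha) q => [//|l s IH] q /= /andP[/andP[l0 la] /IH <-].
case: l l0 la => // l _ la; rewrite /= step_round//.
by rewrite ltn_subrL/= (leq_trans _ la).
Qed.

Lemma path_rounds a x y p :
  foldl (fun h l => layer_path (max_layers a l) h) (state x y p) (iota 1 alpha) =
  state x y (foldl (fun p l => path_round (alpha - l) p) p (iota 1 alpha)).
Proof.
have : all (fun l => 0 < l <= alpha)%N (iota 1 alpha).
  by apply/allP => l; rewrite mem_iota add1n ltnS.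
elim: (iota 1 alpha) p => [//|l s IH] p /= /andP[/andP[l0 la] /IH <-].
case: l l0 la => // l _ la; rewrite /= path_round_layer//.
by rewrite ltn_subrL/= (leq_trans _ la).
Qed.

Lemma max_network (m m' : nat) (k : R) (a : 'I_(2 ^ alpha)) :
  0 <= k -> (forall b, size (zs b) = m) -> (0 < m)%N ->
  (2 ^ alpha * m <= m')%N ->
  exists th : resnet R d m' #|{: @max_state d alpha}| alpha.+1,
    (forall x, rn_eval th x =
       two_layer a x + k * Defs.maxA (fun b => two_layer b x)) /\
    path_norm th <= 3 * two_layer_weight a +
      k * (4 ^+ alpha * \sum_b 3 * two_layer_weight b).
Proof.
move=> k0 szs m0 mm'.
(* The output adds the preserved two-layer value and [k] times slot 0, where the tournament leaves
   the maximum. *)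
pose u : @max_state d alpha -> R := state (fun=> 0) 1 (fun b => (b == 0%N)%:R * k).
pose V (t : @max_state d alpha) (j : 'I_d) : R :=
  state (fun i => (i == j)%:R) 0 (fun=> 0) t.
(* The first layer is the widest, with [2 ^ alpha * m] neurons; a round uses at most [2 ^ alpha]. *)
have sizeL l : (l < alpha.+1)%N -> (size (max_layers a l) <= m')%N.
  case: l => [_|l la]; rewrite /max_layers.
    apply: leq_trans mm'; rewrite size_allpairs_dep.
    rewrite sumnE big_map big_enum /= (eq_bigr (fun=> m))//.
    by rewrite sum_nat_const card_ord.
  rewrite size_map size_iota; apply: leq_trans mm'.
  by rewrite (leq_trans _ (leq_pmulr _ m0))// leq_exp2l// leq_subr.
exists (net_of_layers m' alpha.+1 u V (max_layers a)); split => [x|].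
  rewrite rn_eval_net//= (_ : (fun _ => _) = state (x ord0) 0 (fun=> 0)).
    rewrite step_first step_rounds sum_state /= big1 ?add0r; last first.
      by move=> i _; rewrite mul0r.
    rewrite mul1r; congr (_ + _).
    under eq_bigr do rewrite -mulrA.
    rewrite (sum_delta_nat (fun n => k * foldl _ _ _ n)) ?pow2_gt0//.
    congr (_ * _); apply: tournament_max; apply: is_max_maxA => b.
    exact: extend_ordE.
  apply/funext => -[i|[b|]] /=.
  - rewrite (bigD1 i)//= /V/= eqxx mul1r big1 ?addr0// => j.
    by rewrite eq_sym => /negbTE ->; rewrite mul0r.
  - by rewrite big1// => j _; rewrite /V mul0r.
  - by rewrite big1// => j _; rewrite /V mul0r.
rewrite path_norm_net//= (_ : (fun _ => _) = state (fun=> 1) 0 (fun=> 0)).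
  rewrite path_first path_rounds sum_state /= big1 ?add0r; last first.
    by move=> i _; rewrite normr0 mul0r.
  rewrite normr1 mul1r lerD2l.
  under eq_bigr do rewrite normrM normr_nat (ger0_norm k0) -mulrA.
  rewrite (sum_delta_nat (fun n => k * foldl _ _ _ n)) ?pow2_gt0//.
  rewrite ler_wpM2l//; apply: le_trans (tournament_path _ _) _.
    move=> b; rewrite /extend_ord; case: insubP => // b' _ _.
    by rewrite mulr_ge0// two_layer_weight_ge0.
  rewrite big_mkord le_eqVlt; apply/orP; left; apply/eqP; congr (_ * _).
  by apply: eq_bigr => b _; rewrite extend_ordE.
apply/funext => -[i|[b|]] /=.
- rewrite (bigD1 i)//= /V/= eqxx normr1 big1 ?addr0// => j.
  by rewrite eq_sym => /negbTE ->; rewrite normr0.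
- by rewrite big1// => j _; rewrite /V normr0.
- by rewrite big1// => j _; rewrite /V normr0.
Qed.

End MaxNetworkRealization.

(** * The Bellman loss and the path norm *)

Section MaxA.
Context {R : realType} {alpha : nat}.
Implicit Types F G : 'I_(2 ^ alpha) -> R.

Lemma maxA_ub F a : F a <= Defs.maxA F.
Proof. by rewrite /Defs.maxA; exact: le_bigmax. Qed.

Lemma maxA_attained F : exists a, Defs.maxA F = F a.
Proof.
have [] := @is_max_maxA R alpha F (extend_ord F) (extend_ordE F).
move=> _ [b bN <-]; exists (Ordinal bN).
by rewrite -(extend_ordE F).
Qed.

(** Evaluates the maximum over the networks at the next state, since their tournament term is common
    to all actions. *)
Lemma maxA_addr F k : Defs.maxA (fun a => F a + k) = Defs.maxA F + k.
Proof.
apply/eqP; rewrite eq_le; apply/andP; split.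
  by have [a ->] := maxA_attained (fun a => F a + k); rewrite lerD2r maxA_ub.
by have [a ->] := maxA_attained F; exact: (maxA_ub (fun a => F a + k)).
Qed.

Lemma maxA_dist_le F G e :
  (forall a, `|F a - G a| <= e) -> `|Defs.maxA F - Defs.maxA G| <= e.
Proof.
move=> FG; rewrite ler_norml; apply/andP; split.
  have [a ->] := maxA_attained G; have := maxA_ub F a.
  by have := FG a; rewrite ler_norml => /andP[]; lra.
have [a ->] := maxA_attained F; have := maxA_ub G a.
by have := FG a; rewrite ler_norml => /andP[]; lra.
Qed.

End MaxA.

Lemma sqr_sum_le (R : realFieldType) (n : nat) (F : 'I_n -> R) :
  (\sum_i F i) ^+ 2 <= n%:R * \sum_i F i ^+ 2.
Proof.
rewrite expr2 big_distrlr /=.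
apply: (@le_trans _ _ (\sum_(i < n) \sum_(j < n) (F i ^+ 2 + F j ^+ 2) / 2)).
  apply: ler_sum => i _; apply: ler_sum => j _.
  have := sqr_ge0 (F i - F j); lra.
have inner (i : 'I_n) : \sum_(j < n) (F i ^+ 2 + F j ^+ 2) / 2 =
    (n%:R * F i ^+ 2 + \sum_j F j ^+ 2) / 2.
  by rewrite -mulr_suml big_split /= sumr_const card_ord mulr_natl.
rewrite (eq_bigr _ (fun i _ => inner i)) -mulr_suml big_split /=.
rewrite -mulr_sumr sumr_const card_ord -[X in _ + X]mulr_natl.
lra.
Qed.

Section Assembly.
Context {R : realType} {d alpha : nat}.
Variables (S : set 'rV[R]_d) (r : 'rV[R]_d -> 'I_(2 ^ alpha) -> R).
Let B a := barron_norm S (fun s => r s a).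
Let nA : R := (2 ^ alpha)%:R.
Let rB := barron_norm_r S r.

Let nA1 : 1 <= nA.
Proof. by rewrite ler1n pow2_gt0. Qed.

Let B0 a : 0 <= B a. Proof. exact: barron_norm_ge0. Qed.

Lemma barron_norm_r_ge0 : 0 <= rB.
Proof. exact: sqrtr_ge0. Qed.

Lemma barron_norm_r_sqr : rB ^+ 2 = \sum_a B a ^+ 2.
Proof. by rewrite sqr_sqrtr// sumr_ge0// => a _; exact: sqr_ge0. Qed.

Lemma barron_norm_le_r a : B a <= rB.
Proof.
rewrite -(@ler_pXn2r _ 2)// ?nnegrE ?barron_norm_r_ge0//.
rewrite barron_norm_r_sqr (bigD1 a)//= lerDl sumr_ge0// => b _.
exact: sqr_ge0.
Qed.

Lemma sum_barron_norm_le : \sum_a B a <= Num.sqrt nA * rB.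
Proof.
rewrite -(@ler_pXn2r _ 2)// ?nnegrE ?mulr_ge0 ?sumr_ge0 ?barron_norm_r_ge0//.
rewrite exprMn sqr_sqrtr ?(le_trans ler01)// barron_norm_r_sqr.
exact: sqr_sum_le.
Qed.

Variables (zs : 'I_(2 ^ alpha) -> seq (R * d.-tuple R)) (c : R).
Hypothesis c0 : 0 <= c.
Hypothesis weightB : forall a, two_layer_weight zs c a <= 4 * B a.

(** With W the total weight, the left side is 3W (1 + nA^3 gamma/(1-gamma)), at most 3W
    nA^3/(1-gamma) because nA^3 >= 1. Cauchy-Schwarz gives W <= 4 sqrt(nA) rB, hence the constant
    12, half of the one claimed. *)
Lemma path_norm_family_le (gamma : R) : 0 < gamma < 1 ->
  \sum_a (3 * two_layer_weight zs c a + gamma / (1 - gamma) *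
      (4 ^+ alpha * \sum_b 3 * two_layer_weight zs c b))
    <= 24 / (1 - gamma) * (nA ^+ 3 * Num.sqrt nA) * rB.
Proof.
move=> /andP[g0 g1].
have g1' : 0 < 1 - gamma by rewrite subr_gt0.
pose W := \sum_a two_layer_weight zs c a.
have W3 : \sum_a 3 * two_layer_weight zs c a = 3 * W by rewrite /W mulr_sumr.
rewrite big_split /= W3 sumr_const card_ord -[X in _ + X]mulr_natl -/nA.
have W0 : 0 <= W by rewrite sumr_ge0// => a _; exact: two_layer_weight_ge0.
have W4 : W <= 4 * (Num.sqrt nA * rB).
  apply: (@le_trans _ _ (\sum_a 4 * B a)); first exact: ler_sum.
  by rewrite -mulr_sumr ler_wpM2l// sum_barron_norm_le.
have -> : 4 ^+ alpha = nA ^+ 2 :> R.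
  by rewrite /nA natrX exprAC -[2 ^+ 2]natrX.
have nA3 : 1 <= nA ^+ 3 by rewrite exprn_ege1.
apply: (@le_trans _ _ (3 * nA ^+ 3 / (1 - gamma) * W)).
  rewrite -subr_ge0 (_ : _ - _ = 3 * W * (nA ^+ 3 - 1)).
    by apply: mulr_ge0; [exact: mulr_ge0|rewrite subr_ge0].
  by field; exact: lt0r_neq0.
have K0 : 0 <= 3 * nA ^+ 3 / (1 - gamma).
  by rewrite divr_ge0 ?mulr_ge0 ?(ltW g1')// (le_trans ler01).
apply: (le_trans (ler_wpM2l K0 W4)).
rewrite -subr_ge0 (_ : _ - _ = 4 * (3 * nA ^+ 3 / (1 - gamma)) *
    (Num.sqrt nA * rB)); last by field; exact: lt0r_neq0.
by rewrite !mulr_ge0 ?sqrtr_ge0 ?barron_norm_r_ge0// invr_ge0 ltW.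
Qed.

End Assembly.

(** Since gamma (1 + gamma/(1-gamma)) = gamma/(1-gamma), both maxima carry the same factor. *)
Lemma bellman_residual (R : realFieldType) (gamma q r M M' : R) : gamma < 1 ->
  q + gamma / (1 - gamma) * M - r - gamma * (M' + gamma / (1 - gamma) * M') =
  (q - r) + gamma / (1 - gamma) * (M - M').
Proof. by move=> g1; field; rewrite subr_eq0 eq_sym lt_eqF. Qed.

Lemma sqr_add_le (R : realFieldType) (x y e : R) : `|y| <= e ->
  (x + y) ^+ 2 <= 2 * x ^+ 2 + 2 * e ^+ 2.
Proof.
move=> ye; have y2 : y ^+ 2 <= e ^+ 2.
  by rewrite -(real_normK (num_real y)) ler_pXn2r// ?nnegrE ?(le_trans _ ye).
have := sqr_ge0 (x - y); lra.
Qed.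

(* [iint] is monotone without any measurability assumption, which allows the
   integrand [h], whose dependence on the transition map may be wild, to be
   replaced by a measurable majorant. *)
Lemma unif_exp_le_sum (R : realType) (d n : nat) (S : set 'rV[R]_d)
    (h : 'rV[R]_d -> R) (e : 'I_n -> 'rV[R]_d -> R) (k D V : R) (E : 'I_n -> R) :
  measurable ((@row_of_tuple R d) @^-1` S) ->
  leb_vol S = V%:E -> 0 < V -> 0 <= k -> 0 <= D ->
  (forall v, 0 <= h v) ->
  (forall v, S v -> h v <= \sum_i k * e i v ^+ 2 + D) ->
  (forall i, measurable_fun setT
    (fun t : d.-tuple R => \1_S (row_of_tuple t) * e i (row_of_tuple t) ^+ 2)) ->
  (forall i, (iint (fun v => (\1_S v * e i v ^+ 2)%:E) <= (E i * V)%:E)%E) ->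
  (unif_exp S h <= (\sum_i k * E i + D)%:E)%E.
Proof.
move=> mS volS V0 k0 D0 h0 hle me eE.
have e0 i v : 0 <= \1_S v * e i v ^+ 2 by rewrite mulr_ge0 ?sqr_ge0.
have ke0 i v : (0 <= k%:E * (\1_S v * e i v ^+ 2)%:E)%E.
  by rewrite -EFinM lee_fin mulr_ge0.
have D10 (v : 'rV[R]_d) : (0 <= D%:E * (\1_S v)%:E)%E.
  by rewrite -EFinM lee_fin mulr_ge0.
have m1S : row_measurable (fun v : 'rV[R]_d => (\1_S v : R)%:E).
  by apply/measurable_EFinP; exact: (measurable_indic mS).
have mke i : row_measurable (fun v => (k%:E * (\1_S v * e i v ^+ 2)%:E)%E).
  by apply: measurable_funeM; apply/measurable_EFinP; exact: me.
have main : (iint (fun s => (\1_S s * h s)%:E) <=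
    ((\sum_i k * E i + D) * V)%:E)%E.
  apply: (@le_trans _ _ (iint (fun v =>
    (\sum_(i <- index_enum 'I_n) k%:E * (\1_S v * e i v ^+ 2)%:E +
      D%:E * (\1_S v)%:E)%E))).
    apply: le_iint => v; first by rewrite lee_fin mulr_ge0.
    have [vS|nvS] := boolP (v \in S).
      rewrite indicE vS mul1r mule1.
      under eq_bigr do rewrite mul1r -EFinM.
      rewrite sumEFin -EFinD lee_fin; apply: hle.
      by move: vS; rewrite inE.
    rewrite {1}indicE (negbTE nvS) mul0r adde_ge0// sume_ge0//.
  rewrite iintD//; last 3 first.
  - by move=> v; apply: sume_ge0.
  - by apply: emeasurable_sum => i; exact: mke.
  - exact: measurable_funeM.
  rewrite iint_sum// (iintZl D0 _ m1S)//.
  rewrite -/(leb_vol S) volS -EFinM mulrDl EFinD leeD2r// mulr_suml -sumEFin.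
  apply: lee_sum => i _; rewrite iintZl//; last 2 first.
  - by move=> v; rewrite lee_fin.
  - by apply/measurable_EFinP; exact: me.
  by rewrite -mulrA [leRHS]EFinM lee_wpmul2l.
rewrite /unif_exp volS /=.
apply: (le_trans (lee_wpmul2r _ main)); first by rewrite lee_fin invr_ge0 ltW.
by rewrite -EFinM mulfK// gt_eqF.
Qed.

Theorem theorem3p5 (R : realType) (d alpha : nat) (S : set 'rV[R]_d)
  (gamma : R) (r : 'rV[R]_d -> 'I_(2 ^ alpha) -> R)
  (g : 'rV[R]_d -> 'I_(2 ^ alpha) -> R -> 'rV[R]_d) (CT dt : R) (m : nat) :
  (0 < d)%N ->
  compact S ->
  (forall s, S s -> forall i, 0 <= s ord0 i <= 1) ->
  (0 < leb_vol S)%E ->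
  0 < gamma < 1 ->
  (forall a, {within S, continuous (fun s => r s a)}) ->
  (forall a, in_barron S (fun s => r s a)) ->
  (forall s a, S s -> `|r s a| <= 1) ->
  (forall s a t, S s -> 0 <= t -> S (g s a t)) ->
  (forall s a, S s -> g s a 0 = s) ->
  (forall s a t t', S s -> 0 <= t -> 0 <= t' ->
     g (g s a t) a t' = g s a (t + t')) ->
  0 < CT ->
  (forall s a t De, S s -> 0 <= t -> 0 < De < 1 ->
     linf_dist (g s a t) (g s a (t + De)) <= CT * De) ->
  0 < dt < 1 ->
  (0 < m)%N ->
  exists D0 : nat, (0 < D0)%N /\
  exists Th : 'I_(2 ^ alpha) -> resnet R d ((6 ^ alpha).+1 * m) D0 alpha.+1,
    let nA : R := (2 ^ alpha)%:R in
    let rB : R := barron_norm_r S r in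
    (bellman_loss S r g gamma dt Th <=
      ((1 - gamma) ^- 2 *
        (256%:R * nA ^+ 5 * rB ^+ 2 / m%:R
         + 576%:R * gamma ^+ 2 * CT ^+ 2 * dt ^+ 2 * nA ^+ 7 * rB ^+ 2))%:E)%E
    /\ family_path_norm Th <= 24%:R / (1 - gamma) * (nA ^+ 3 * Num.sqrt nA) * rB.
Proof.
move=> _ cS S01 vol0 g01 _ Br _ _ gid _ CT0 glip dt01 m0.
have /andP[g0 g1] := g01; have /andP[dt0 dt1] := dt01.
have g1' : 0 < 1 - gamma by rewrite subr_gt0.
have m0R : 0 < m%:R :> R by rewrite ltr0n.
pose kappa := gamma / (1 - gamma).
have kappa0 : 0 <= kappa by rewrite divr_ge0 ?ltW.
have [V volS] : exists V, leb_vol S = V%:E.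
  exists (fine (leb_vol S)); rewrite fineK// ge0_fin_numE ?(ltW vol0)//.
  exact: le_lt_trans (leb_vol_cube_le1 S01) (ltry _).
have V0 : 0 < V by move: vol0; rewrite volS lte_fin.
have mS := compact_row_measurable cS.
have /choice[zs zsP] a := barron_approx mS S01 volS V0 (Br a) m0.
pose c : R := m%:R^-1.
have c0 : 0 <= c by rewrite invr_ge0 ltW.
have szs b : size (zs b) = m by case: (zsP b).
have sizes : (2 ^ alpha * m <= (6 ^ alpha).+1 * m)%N.
  rewrite leq_mul2r; apply/orP; right; apply: leqW.
  by case: {+}alpha => // n; rewrite leq_exp2r.
have /choice[Th ThP] a := max_network c0 a kappa0 szs m0 sizes.
exists #|{: @max_state d alpha}|; split.
  by apply/card_gt0P; exists (inr None).
exists Th => nA rB.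
have weightB a : two_layer_weight zs c a <= 4 * barron_norm S (fun s => r s a).
  by case: (zsP a).
have rB0 : 0 <= rB := barron_norm_r_ge0 S r.
have nA1 : 1 <= nA by rewrite ler1n pow2_gt0.
split; last first.
  apply: (@le_trans _ _ _ _ _ _ (path_norm_family_le c0 weightB g01)).
  by apply: ler_sum => a _; case: (ThP a).
pose q b s := two_layer zs c b s.
(* Every two-layer network has Lipschitz constant at most 4 rB, and one time step moves the state by
   at most [CT * dt]. *)
pose delta := kappa * (4 * rB * (CT * dt)).
have resid a s : S s -> (rn_eval (Th a) s - r s a -
      gamma * Defs.maxA (fun a' => rn_eval (Th a') (g s a dt))) ^+ 2 <=
    2 * (q a s - r s a) ^+ 2 + 2 * delta ^+ 2.
  move=> Ss; set s' := g s a dt.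
  have -> : (fun a' => rn_eval (Th a') s') =
      (fun a' => q a' s' + kappa * Defs.maxA (fun b => q b s')).
    by apply/funext => a'; case: (ThP a') => ->.
  rewrite (ThP a).1 maxA_addr bellman_residual//.
  apply: sqr_add_le; rewrite normrM (ger0_norm kappa0) ler_wpM2l//.
  apply: maxA_dist_le => b; apply: le_trans (two_layer_lipschitz zs c0 b s s') _.
  apply: ler_pM; rewrite ?two_layer_weight_ge0//.
  - by rewrite /linf_dist; apply: le_trans (bigmax_ge_id _ _ _ _).
  - apply: le_trans (weightB b) _; rewrite ler_wpM2l//.
    exact: barron_norm_le_r.
  - by have := glip s a 0 dt Ss (lexx 0) dt01; rewrite gid// add0r.
rewrite /bellman_loss.
set h := fun s : 'rV[R]_d => _.
pose E a := 8 * barron_norm S (fun s => r s a) ^+ 2 / m%:R.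
have hle : (unif_exp S h <= (\sum_a (nA^-1 * 2) * E a + 2 * delta ^+ 2)%:E)%E.
  have nA0 : 0 < nA by exact: lt_le_trans ltr01 nA1.
  apply: (@unif_exp_le_sum _ _ _ _ _ (fun a s => q a s - r s a) _ _ V) => //.
  - by rewrite mulr_ge0// invr_ge0 ltW.
  - by rewrite mulr_ge0 ?sqr_ge0.
  - move=> v; rewrite mulr_ge0 ?invr_ge0 ?(ltW nA0)// sumr_ge0// => a _.
    exact: sqr_ge0.
  - move=> v Sv; rewrite /h ler_pdivrMl//.
    apply: (@le_trans _ _ (\sum_a (2 * (q a v - r v a) ^+ 2 + 2 * delta ^+ 2))).
      by apply: ler_sum => a _; exact: resid.
    rewrite big_split /= sumr_const card_ord -[X in _ + X]mulr_natl -/nA mulrDr.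
    rewrite lerD2r mulr_sumr; apply: ler_sum => a _.
    by rewrite !mulrA divff ?mul1r// gt_eqF.
  - move=> a; have [rho rhoP] := Br a.
    have mr := barron_rep_measurable mS rhoP.
    (* The outer indicator allows [r] to be truncated to [S], where its Barron representation makes
       it measurable. *)
    rewrite (_ : (fun _ => _) = (fun t : d.-tuple R => \1_S (row_of_tuple t) *
        (q a (row_of_tuple t) -
         \1_S (row_of_tuple t) * r (row_of_tuple t) a) ^+ 2)).
      apply: measurable_funM; first exact: (measurable_indic mS).
      apply: measurable_funX; apply: measurable_funB => //.
      apply: measurable_funM => //; apply: measurable_sum => z.
      exact: measurable_neuronr.
    apply/funext => t; rewrite indicE; case: (_ \in _); last by rewrite !mul0r.
    by rewrite !mul1r.
  - by move=> a; case: (zsP a).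
apply: (le_trans (lee_wpmul2l _ hle)); first by rewrite lee_fin.
rewrite -EFinM lee_fin.
have rB2 : \sum_a (nA^-1 * 2) * E a = 16 * rB ^+ 2 / m%:R / nA.
  rewrite /rB barron_norm_r_sqr -mulr_sumr /E -!mulr_suml -mulr_sumr.
  by field; rewrite !gt_eqF// (lt_le_trans ltr01).
rewrite rB2.
(* The bound reached is 8 rB^2/(m nA) + delta^2, where delta^2 is 16 G gamma^2 CT^2 dt^2 rB^2. As
   [G] and [nA] are at least 1, the constants 256 and 576 and the powers of [nA] dominate it. *)
pose G := (1 - gamma) ^- 2.
have G1 : 1 <= G.
  rewrite /G invf_ge1 ?exprn_gt0// expr_le1 ?(ltW g1')//.
  by rewrite gerBl ltW.
have X0 : 0 <= rB ^+ 2 / m%:R by rewrite divr_ge0 ?sqr_ge0 ?ltW.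
have Y0 : 0 <= gamma ^+ 2 * CT ^+ 2 * dt ^+ 2 * rB ^+ 2 by rewrite -!exprMn sqr_ge0.
have dE : delta ^+ 2 = 16 * (G * (gamma ^+ 2 * CT ^+ 2 * dt ^+ 2 * rB ^+ 2)).
  by rewrite /delta /kappa /G; field; exact: lt0r_neq0.
have nA5 : 1 <= nA ^+ 5 by exact: exprn_ege1.
have nA7 : 1 <= nA ^+ 7 by exact: exprn_ege1.
have nAV : nA^-1 <= 1 by rewrite invf_le1// (lt_le_trans ltr01).
have GX : rB ^+ 2 / m%:R * nA^-1 <= G * (nA ^+ 5 * (rB ^+ 2 / m%:R)).
  apply: (@le_trans _ _ (rB ^+ 2 / m%:R)); first by rewrite ler_piMr.
  rewrite [leRHS]mulrA ler_peMl//.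
  by rewrite -[leLHS]mulr1 ler_pM.
have GX0 : 0 <= G * (nA ^+ 5 * (rB ^+ 2 / m%:R)).
  apply: mulr_ge0; first exact: le_trans G1.
  by apply: mulr_ge0 => //; exact: le_trans nA5.
have GY : G * (gamma ^+ 2 * CT ^+ 2 * dt ^+ 2 * rB ^+ 2) <=
    G * (nA ^+ 7 * (gamma ^+ 2 * CT ^+ 2 * dt ^+ 2 * rB ^+ 2)).
  by rewrite ler_wpM2l ?(le_trans ler01)// ler_peMl.
have GY0 : 0 <= G * (nA ^+ 7 * (gamma ^+ 2 * CT ^+ 2 * dt ^+ 2 * rB ^+ 2)).
  apply: mulr_ge0; first exact: le_trans G1.
  by apply: mulr_ge0 => //; exact: le_trans nA7.
rewrite [leRHS](_ : _ = 256 * (G * (nA ^+ 5 * (rB ^+ 2 / m%:R))) +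
  576 * (G * (nA ^+ 7 * (gamma ^+ 2 * CT ^+ 2 * dt ^+ 2 * rB ^+ 2)))); last first.
  by rewrite /G; ring.
rewrite [leLHS](_ : _ = 8 * (rB ^+ 2 / m%:R * nA^-1) + delta ^+ 2); last first.
  by field; rewrite !gt_eqF// (lt_le_trans ltr01).
rewrite dE; lra.
Qed.
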